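(* Let $\Gamma$ be a finite connected 4-regular graph (loops and multiple edges allowed) and let $T$ be a transition system of $\Gamma$. Let $w$ be an Euler tour of $\Gamma$ orthogonal to $T$ and let $G_w$ be the associated bicoloured graph. Then $T$ admits no orthogonal cycle decomposition if and only if the parity class $[G_w]$ is pure.
   Context: At each vertex $u$ of $\Gamma$ there are four edge-ends (a loop contributes two). A transition system $T$ of $\Gamma$ assigns to every vertex $u$ a partition of its four edge-ends into two pairs (the transitions of $T$ at $u$). A cycle is a connected 2-regular (sub)graph (a loop is a 1-cycle, two parallel edges form a 2-cycle); a cycle decomposition of $\Gamma$ is a partition of $E(\Gamma)$ into cycles; at each vertex $u$ it pairs the edge-ends at $u$ belonging to the same cycle consecutively. An Euler tour (closed trail using every edge once) passes twice through each vertex and each passage pairs the entering and leaving edge-ends. A cycle decomposition or Euler tour is orthogonal to $T$ if none of the pairs it induces is a pair of $T$. (Euler tours orthogonal to $T$ exist.) Given such a tour $w$, $G_w$ is the bicoloured simple graph with vertex set $V(\Gamma)$, in which distinct $u,v$ are adjacent iff their occurrences interlace in the cyclic sequence of vertices of $w$ (i.e. the cyclic sequence reads $\ldots u\ldots v\ldots u\ldots v\ldots$), and, fixing a direction of traversal of $w$, $u$ is black iff the entering edge-ends of the two passages of $w$ through $u$ lie in the same pair of $T$, white otherwise. Bicoloured local complementation: for a bicoloured graph $G$ and $u\in V(G)$, $Gu$ has edge set $E(G)\triangle\{[x,y]:x\ne y\in N_G(u)\}$ and the same colouring if $u$ is black, while if $u$ is white the colours of all vertices of $N_G(u)$ are reversed;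 $Gu_1\cdots u_k=(\cdots(Gu_1)\cdots)u_k$. $W^\circ(G)$ is the smallest set of words containing the empty word such that $s\in W^\circ(G)$, $u$ white in $Gs$ implies $su\in W^\circ(G)$, and $s\in W^\circ(G)$, $u,v$ adjacent black in $Gs$ implies $suvu,svuv\in W^\circ(G)$. $[G]=\{Gs:s\in W^\circ(G)\}$. A black anticlique is a maximal independent set consisting of black vertices; $[G]$ is pure if no member has a black anticlique. *)

(* Defs.v *)
From mathcomp Require Import all_boot.

Set Implicit Arguments.
Unset Strict Implicit.
Unset Printing Implicit Defensive.

(** * Finite multigraphs *)

(* The edge e has the two edge-ends (e, false) and (e, true), attached to the
   vertices att (e, false) and att (e, true); these coincide for a loop, which
   thus contributes two edge-ends to its vertex. *)
Record mgraph := MGraph {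
  vert : finType;
  edge : finType;
  att : edge * bool -> vert
}.

Notation edge_end Gam := (edge Gam * bool)%type.

Section Multigraph.
Variable Gam : mgraph.
Implicit Types (u v x y : vert Gam) (h d : edge_end Gam).
Implicit Types (C : {set edge Gam}) (D : {set {set edge Gam}}).
Implicit Types (w : seq (edge_end Gam)).

Definition opp h : edge_end Gam := (h.1, ~~ h.2).

Definition ends_at u : {set edge_end Gam} := [set h | att h == u].

Definition four_regular : Prop := forall u, #|ends_at u| = 4.

Definition ends_in C u : {set edge_end Gam} := [set h in ends_at u | h.1 \in C].

Definition verts_of C : {set vert Gam} := [set u | ends_in C u != set0].

Definition joined_in C : rel (vert Gam) := fun x y =>
  [exists h : edge_end Gam, [&& h.1 \in C, att h == x & att (opp h) == y]].

(* The subgraph with vertex set U and edge set C is connected (and nonempty). *)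
Definition sub_connected (U : {set vert Gam}) C : Prop :=
  U != set0 /\ {in U &, forall x y, connect (joined_in C) x y}.

Definition connected : Prop := sub_connected setT setT.

(* A cycle is given by its edge set C; its vertices are those incident to C. *)
Definition is_cycle C : Prop :=
  sub_connected (verts_of C) C /\ {in verts_of C, forall u, #|ends_in C u| = 2}.

Definition cycle_decomposition D : Prop :=
  partition D [set: edge Gam] /\ {in D, forall C, is_cycle C}.

Definition decomposition_pairs D u : {set {set edge_end Gam}} :=
  [set ends_in C u | C in D & u \in verts_of C].

Definition transition_system (T : vert Gam -> {set {set edge_end Gam}}) : Prop :=
  forall u, partition (T u) (ends_at u) /\ {in T u, forall P : {set edge_end Gam}, #|P| = 2}.

(* The edge-end d also stands for its edge traversed from d to opp d.  A closed
   trail is listed from an arbitrary starting point, and read cyclically. *)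
Definition euler_tour w : Prop :=
  [/\ uniq [seq d.1 | d <- w],
      forall e, e \in [seq d.1 | d <- w]
    & path.cycle (fun d d' => att (opp d) == att d') w].

(* A passage at u enters by opp d and leaves by the next item of w. *)
Definition tour_pairs w u : {set {set edge_end Gam}} :=
  [set [set opp d; next w d] | d in w & att (opp d) == u].

Definition orthogonal (T P : vert Gam -> {set {set edge_end Gam}}) : Prop :=
  forall u, [disjoint P u & T u].

Definition entering_ends w u : {set edge_end Gam} :=
  [set opp d | d in w & att (opp d) == u].

Definition tour_vertices w : seq (vert Gam) := [seq att d | d <- w].

End Multigraph.

(* u ... v ... u ... v is read in the cyclic sequence s from some starting point. *)
Definition interlaced (V : eqType) (s : seq V) (u v : V) : bool :=
  [exists n : 'I_(size s).+1, subseq [:: u; v; u; v] (rot n s)].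

Lemma interlaced_sym (V : eqType) (s : seq V) : symmetric (interlaced s).
Proof.
suff imp u v : interlaced s u v -> interlaced s v u.
  by move=> u v; apply/idP/idP; apply: imp.
case/existsP=> n.
have rot_rot m : exists k : 'I_(size s).+1, rot k s = rot m (rot n s).
  have le_n : n <= size s by rewrite -ltnS.
  have [le_m|/ltnW le_m] := leqP m (size s); last first.
    by exists n; rewrite (rot_oversize (s := rot n s)) // size_rot.
  have lt_k : (if m + n <= size s then m + n else m + n - size s) < (size s).+1.
    by rewrite ltnS; case: ifP => // _; rewrite leq_subLR leq_add.
  by exists (Ordinal lt_k); rewrite rot_add_mod.
have split_u t : subseq [:: u; v; u; v] t ->
    exists t1 t2, t = rcons t1 u ++ t2 /\ subseq [:: v; u; v] t2.
  elim: t => //= x t IHt; case: eqP => [-> sub_t | _ /IHt].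
    by exists [::], t.
  by case=> t1 [t2] [-> sub_t2]; exists (x :: t1), t2.
case/split_u=> t1 [t2] [def_t sub_t2].
have [k def_k] := rot_rot (size (rcons t1 u)).
apply/existsP; exists k; rewrite def_k def_t rot_size_cat.
rewrite (cat_subseq (s1 := [:: v; u; v]) (s2 := [:: u])) //.
by rewrite sub1seq mem_rcons inE eqxx.
Qed.

(** * Bicoloured graphs *)

Record bigraph (V : finType) := Bigraph {
  adj : rel V;
  black : pred V;
  adj_sym : symmetric adj;
  adj_irr : irreflexive adj
}.

Section Bigraph.
Variable V : finType.
Implicit Types (G H : bigraph V) (u v x y : V) (s : seq V).

Definition white G u : bool := ~~ black G u.

(* Bicoloured local complementation Gu; lcs G s is Gs for a word s, and
   admissible G is the set of words W°(G). *)
Definition lc_adj G u : rel V := fun x y =>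
  adj G x y (+) [&& x != y, adj G u x & adj G u y].

Definition lc_black G u : pred V := fun x =>
  if black G u then black G x else black G x (+) adj G u x.

Lemma lc_adj_sym G u : symmetric (lc_adj G u).
Proof.
by move=> x y; rewrite /lc_adj adj_sym eq_sym (andbC (adj G u x)).
Qed.

Lemma lc_adj_irr G u : irreflexive (lc_adj G u).
Proof. by move=> x; rewrite /lc_adj adj_irr eqxx. Qed.

Definition lc G u : bigraph V :=
  Bigraph (lc_black G u) (@lc_adj_sym G u) (@lc_adj_irr G u).

Definition lcs G s : bigraph V := foldl lc G s.

Inductive admissible G : seq V -> Prop :=
| admissible_nil : admissible G [::]
| admissible_white s u :
    admissible G s -> white (lcs G s) u -> admissible G (s ++ [:: u])
| admissible_suvu s u v :
    admissible G s -> adj (lcs G s) u v ->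
    black (lcs G s) u -> black (lcs G s) v -> admissible G (s ++ [:: u; v; u])
| admissible_svuv s u v :
    admissible G s -> adj (lcs G s) u v ->
    black (lcs G s) u -> black (lcs G s) v -> admissible G (s ++ [:: v; u; v]).

Definition parity_class G : bigraph V -> Prop := fun H =>
  exists2 s, admissible G s & H = lcs G s.

Definition independent G : pred {set V} := fun A =>
  [forall x in A, forall y in A, ~~ adj G x y].

(* Maximality is among all independent sets, not only among the black ones. *)
Definition black_anticlique G (A : {set V}) : bool :=
  maxset (independent G) A && [forall x in A, black G x].

Definition pure (K : bigraph V -> Prop) : Prop :=
  forall H, K H -> ~ exists A, black_anticlique H A.

End Bigraph.

(** * The bicoloured graph of an Euler tour *)

Section TourGraph.
Variable Gam : mgraph.
Variables (T : vert Gam -> {set {set edge_end Gam}}) (w : seq (edge_end Gam)).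

Definition tour_adj : rel (vert Gam) := fun u v =>
  (u != v) && interlaced (tour_vertices w) u v.

Definition tour_black : pred (vert Gam) := fun u =>
  [exists P in T u, entering_ends w u \subset P].

Lemma tour_adj_sym : symmetric tour_adj.
Proof. by move=> u v; rewrite /tour_adj eq_sym interlaced_sym. Qed.

Lemma tour_adj_irr : irreflexive tour_adj.
Proof. by move=> u; rewrite /tour_adj eqxx. Qed.

Definition tour_graph : bigraph (vert Gam) :=
  Bigraph tour_black tour_adj_sym tour_adj_irr.

End TourGraph.

(* Main.v *)
(* At each vertex two transitions are orthogonal to T, so an orthogonal tour w
   differs from any orthogonal decomposition exactly by switching the transition
   at the vertices of some set X.  Switching a white vertex reverses one of the
   two closed trails into which the vertex cuts w, and switching two interlaced
   black vertices exchanges two of the four trails into which they cut w; both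
   yield orthogonal tours, whose graphs are Gu and Guvu = Gvuv up to equality of
   adjacency and colours.  So all members of [G_w] are graphs of orthogonal tours.

   Switching all vertices of a black independent set X splits w into as many
   closed trails as the non-crossing chords X cut regions in the disk, and a
   vertex outside X meets two regions iff it crosses some chord of X.  Hence a
   black anticlique yields a cycle decomposition.  Conversely, a tour of the orbit
   differing from a given decomposition at as few vertices as possible differs
   from it on a black independent set, which is maximal because otherwise some
   cycle of the decomposition would pass twice through a vertex.  *)

Require Import Defs.
From mathcomp Require Import all_boot zify.

Set Implicit Arguments.
Unset Strict Implicit.
Unset Printing Implicit Defensive.

(** * Interlacement in words *)

Section Words.
Variable V : eqType.
Implicit Types (s t : seq V) (x y z u v : V).

(** Counting modulo 2 makes the effect of cutting and regluing a word bilinear in these parities, so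
    rearrangements of a tour reduce to Boolean identities. *)
Definition occ s x : bool := odd (count_mem x s).

(* The parity of the number of pairs of positions i < j of s carrying y, x. *)
Fixpoint prec s y x : bool :=
  if s is z :: s' then prec s' y x (+) ((z == y) && occ s' x) else false.

Lemma occ_cat s1 s2 x : occ (s1 ++ s2) x = occ s1 x (+) occ s2 x.
Proof. by rewrite /occ count_cat oddD. Qed.

Lemma occ_cons z s x : occ (z :: s) x = (z == x) (+) occ s x.
Proof. by rewrite -cat1s occ_cat {1}/occ /= addn0 oddb. Qed.

Lemma occ_nil x : occ [::] x = false. Proof. by []. Qed.

Lemma occ_rev s x : occ (rev s) x = occ s x.
Proof. by rewrite /occ count_rev. Qed.

Lemma prec_cat s1 s2 y x :
  prec (s1 ++ s2) y x =
  prec s1 y x (+) prec s2 y x (+) (occ s1 y && occ s2 x).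
Proof.
elim: s1 => [|z s1 IHs] /=; first by rewrite addbF.
rewrite IHs occ_cat occ_cons.
by case: (z == y); case: (prec s1 y x); case: (prec s2 y x);
  case: (occ s1 y); case: (occ s2 x); case: (occ s1 x).
Qed.

Lemma prec_rev s y x : prec (rev s) y x = prec s x y.
Proof.
elim: s => //= z s IHs.
rewrite rev_cons -cats1 prec_cat IHs occ_rev /= occ_cons occ_nil.
by rewrite andbF !addbF andbC.
Qed.

(** Each choice of one occurrence of [x] and one of [y] is counted in exactly one of the two orders,
    so the sum is the product of the two counts modulo 2. *)
Lemma prec_sym s y x :
  y != x -> prec s y x (+) prec s x y = occ s x && occ s y.
Proof.
move=> neq_yx; elim: s => //= z s IHs; rewrite !occ_cons.
have: ~~ ((z == y) && (z == x)).
  by apply/negP=> /andP[/eqP-> /eqP eq_yx]; rewrite eq_yx eqxx in neq_yx.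
move: IHs; case: (z == y); case: (z == x) => //=;
by case: (prec s y x); case: (prec s x y); case: (occ s x); case: (occ s y).
Qed.

(** Evenness gives a letter the same parity in the prefix and in the suffix, so the cross terms
    before and after the rotation agree. *)
Lemma prec_rot n s y x :
  ~~ occ s y -> ~~ occ s x -> prec (rot n s) y x = prec s y x.
Proof.
rewrite -{1 2 4}(cat_take_drop n s) /rot !prec_cat !occ_cat.
case: (occ (take n s) y); case: (occ (take n s) x);
case: (occ (drop n s) y); case: (occ (drop n s) x) => //= _ _;
by case: (prec (take n s) y x); case: (prec (drop n s) y x).
Qed.

Lemma prec_notin s y x : count_mem y s = 0 -> prec s y x = false.
Proof.
elim: s => //= z s IHs; case: eqVneq => //= _ /IHs->.
by [].
Qed.

Lemma prec_notinr s y x : count_mem x s = 0 -> prec s y x = false.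
Proof.
elim: s => //= z s IHs /eqP; rewrite addn_eq0 => /andP[_ /eqP sx].
by rewrite IHs // /occ sx andbF.
Qed.

Lemma prec_filter s y x : prec (filter (pred2 y x) s) y x = prec s y x.
Proof.
have occ_filter r : occ (filter (pred2 y x) r) x = occ r x.
  rewrite /occ count_filter; congr odd; apply: eq_count => z /=.
  by case: eqVneq => //= _; rewrite orbT.
elim: s => //= z s IHs; case: (eqVneq z y) => [->|] /=.
  by rewrite eqxx occ_filter IHs.
by move=> /negPf neq_zy; case: ifP => _ /=; rewrite ?neq_zy !addbF.
Qed.

(** Of the six arrangements, [uvuv] and [vuvu] have 3 and 1 pairs with [u] before [v]; the others
    have 0, 2 or 4. *)
Lemma prec_pair_word q u v :
    u != v -> all (pred2 u v) q -> count_mem u q = 2 -> count_mem v q = 2 ->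
  size q = 4 /\ prec q u v = (q \in [:: [:: u; v; u; v]; [:: v; u; v; u]]).
Proof.
move=> neq_uv q_uv qu qv.
have size_q: size q = 4.
  have disj : count (predI (pred1 u) (pred1 v)) q = 0.
    rewrite -(count_pred0 q); apply: eq_count => z /=.
    by case: eqVneq => //= ->; apply: negbTE.
  have := count_predUI (pred1 u) (pred1 v) q.
  rewrite qu qv disj addn0 => count_uv.
  by move: q_uv; rewrite all_count => /eqP <-.
split=> //; have neq_vu : v != u by rewrite eq_sym.
have ltr z : pred2 u v z -> exists b : bool, z = if b then u else v.
  by case/orP=> /eqP->; [exists true | exists false].
case: q size_q q_uv qu qv => [|a [|b [|c [|d [|? ?]]]]] //= _.
case/and5P=> /ltr[ba ->] /ltr[bb ->] /ltr[bc ->] /ltr[bd ->] _.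
rewrite /occ /= !inE !eqseq_cons.
case: ba; case: bb; case: bc; case: bd;
  by rewrite /= ?eqxx ?(negPf neq_uv) ?(negPf neq_vu).
Qed.

(** The parity survives rotation and the deletion of other letters, which leaves a word of length
    four; interlacement thus needs no choice of starting point. *)
Lemma interlacedE s u v :
    u != v -> count_mem u s = 2 -> count_mem v s = 2 ->
  interlaced s u v = prec s u v.
Proof.
move=> neq_uv su sv.
have pair_word r : count_mem u r = 2 -> count_mem v r = 2 ->
    let q := filter (pred2 u v) r in
    size q = 4 /\ prec q u v = (q \in [:: [:: u; v; u; v]; [:: v; u; v; u]]).
  move=> ru rv; apply: prec_pair_word => //; first exact: filter_all.
    by rewrite -ru count_filter; apply: eq_count => z /=; case: eqVneq.
  rewrite -rv count_filter; apply: eq_count => z /=.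
  by case: (z == v); rewrite ?orbT.
apply/idP/idP => [/existsP[n sub_t] | ].
  rewrite -(@prec_rot n) /occ ?su ?sv // -prec_filter.
  have [||size_q ->] := pair_word (rot n s).
  - by rewrite -su; apply/permP; rewrite perm_rot.
  - by rewrite -sv; apply/permP; rewrite perm_rot.
  have sub_q : subseq [:: u; v; u; v] (filter (pred2 u v) (rot n s)).
    by rewrite subseq_filter /= !eqxx !orbT.
  have [_] := size_subseq_leqif sub_q.
  by rewrite size_q eqxx => /esym/eqP <-; rewrite mem_head.
have [//|//|_] := pair_word s; rewrite prec_filter => ->.
rewrite !inE => /orP[] /eqP def_q.
  by apply/existsP; exists ord0; rewrite rot0 -def_q filter_subseq.
rewrite interlaced_sym; apply/existsP; exists ord0.
by rewrite rot0 -def_q filter_subseq.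
Qed.

(* Chords are the pairs of positions of one letter; side s y i tells whether
   position i lies on the arc from the first to the second y. *)
Definition side s y i : bool := occ (take i.+1 s) y.

Lemma side_next x0 s y i :
  i.+1 < size s -> side s y i.+1 = side s y i (+) (nth x0 s i.+1 == y).
Proof.
move=> lt_i; rewrite /side (take_nth x0 lt_i) -cats1 occ_cat occ_cons.
by rewrite addbF.
Qed.

Lemma take_size_add s1 s2 n : take (size s1 + n) (s1 ++ s2) = s1 ++ take n s2.
Proof. by rewrite takeD take_size_cat // drop_size_cat. Qed.

Lemma split_chord x0 s x p q :
    count_mem x s = 2 -> p < q < size s -> nth x0 s p = x -> nth x0 s q = x ->
  exists s1 s2 s3, [/\ s = s1 ++ x :: s2 ++ x :: s3, size s1 = p,
    (size s1 + size s2).+1 = q & (count_mem x s1 = 0) * (count_mem x s2 = 0) *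
      (count_mem x s3 = 0)].
Proof.
move=> sx /andP[lt_pq lt_q] sp sq; have lt_p := ltn_trans lt_pq lt_q.
have def_q : q - p.+1 + p.+1 = q by rewrite subnK.
have size1 : size (take p s) = p by rewrite size_take lt_p.
have size2 : size (take (q - p.+1) (drop p.+1 s)) = q - p.+1.
  by rewrite size_takel // size_drop leq_sub2r // ltnW.
have def_s : s = take p s ++
    x :: take (q - p.+1) (drop p.+1 s) ++ x :: drop q.+1 s.
  rewrite -{1}(cat_take_drop p s) (drop_nth x0) // sp; congr (_ ++ _ :: _).
  rewrite -{1}(cat_take_drop (q - p.+1) (drop p.+1 s)) drop_drop def_q.
  by rewrite [drop q s](drop_nth x0) // sq.
exists (take p s), (take (q - p.+1) (drop p.+1 s)), (drop q.+1 s).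
split=> //; first by rewrite size1 size2 addnC -addnS def_q.
move: sx; rewrite {1}def_s count_cat /= count_cat /= eqxx !add1n !addnS.
by case=> /eqP; rewrite !addn_eq0 => /and3P[/eqP-> /eqP-> /eqP->].
Qed.

(** The side of [y] changes at each [y] met after the first [x], up to the second. For [y = x] this
    happens once, at the end; otherwise it counts the [y] between the two [x], and a [y] before both
    contributes evenly to [prec]. *)
Lemma side_chord x0 s y x p q :
    count_mem x s = 2 -> p < q < size s -> nth x0 s p = x -> nth x0 s q = x ->
  side s y p (+) side s y q = (x == y) || prec s y x.
Proof.
move=> sx lt_pq sp sq.
have [s1 [s2 [s3 [-> <- <- [[s1x s2x] s3x]]]]] := split_chord sx lt_pq sp sq.
have take1 : take (size s1).+1 (s1 ++ x :: s2 ++ x :: s3) = s1 ++ [:: x].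
  by rewrite -addn1 take_size_add /= take0.
have take2 : take (size s1 + size s2).+2 (s1 ++ x :: s2 ++ x :: s3) =
    s1 ++ x :: s2 ++ [:: x].
  by rewrite -!addnS take_size_add /= -addn1 take_size_add /= take0.
rewrite /side take1 take2 !prec_cat /= !prec_cat /= !(occ_cat, occ_cons, occ_nil).
have [<- | neq_xy] /= := eqVneq x y.
  by rewrite /occ s1x s2x.
rewrite eqxx !prec_notinr // /occ s2x s3x /= andbT andbF !addbF.
by rewrite addKb.
Qed.

(* If position i is followed by a letter y of X, it lies outside the chord y;
   jumping to the second y changes the side of no chord of X, as y crosses
   none of them, and comes strictly closer to j. *)
Lemma same_side_related x0 s (X : pred V) (R : nat -> nat -> Prop) :
    (forall y, y \in s -> count_mem y s = 2) ->
    {in X &, forall x y, x != y -> ~~ prec s y x} ->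
    (forall i, R i i) -> (forall i j k, R i j -> R j k -> R i k) ->
    (forall i, i.+1 < size s -> ~~ X (nth x0 s i.+1) -> R i i.+1) ->
    (forall p q, p.+1 < q < size s -> nth x0 s p.+1 = nth x0 s q ->
       X (nth x0 s q) -> R p q) ->
  forall i j, i <= j < size s -> (forall y, X y -> side s y i = side s y j) ->
  R i j.
Proof.
move=> s2 indepX Rxx Rtrans Rstep Rjump i j; move def_n: (j - i) => n.
elim/ltn_ind: n i def_n => n IHn i def_n /andP[le_ij lt_j] eq_ij.
move: le_ij; rewrite leq_eqVlt => /orP[/eqP-> // | lt_ij].
have lt_i1 : i.+1 < size s by apply: leq_ltn_trans lt_j.
set y := nth x0 s i.+1; have s2y : count_mem y s = 2 by apply/s2/mem_nth.
have [Xy | notXy] := boolP (X y); last first.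
  apply: Rtrans (Rstep _ lt_i1 notXy) _.
  apply: (IHn (j - i.+1)) => //; first by rewrite -def_n ltn_sub2l.
    by rewrite lt_ij.
  move=> z Xz; rewrite -eq_ij // (side_next x0) // -/y.
  by case: eqP Xz notXy => [<- -> | _ _ _]; rewrite ?addbF.
have [q /andP[lt_q le_qj] sq] : exists2 q, i.+1 < q <= j & nth x0 s q = y.
  have : y \in drop i.+2 (take j.+1 s).
    apply/negPn/negP=> /count_memPn y_none; move: (eq_ij y Xy).
    rewrite {2}/side -(cat_take_drop i.+2 (take j.+1 s)) take_takel // occ_cat.
    rewrite {2}/occ y_none addbF -/(side s y i.+1) (side_next x0) //.
    by rewrite eqxx; case: (side s y i).
  case/(nthP x0)=> k; rewrite size_drop size_take_min nth_drop => lt_k.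
  have lt_kj : i.+2 + k < j.+1.
    by move: lt_k; rewrite ltn_subRL => /leq_trans; apply; apply: geq_minl.
  by rewrite nth_take // => sk; exists (i.+2 + k); rewrite // leq_addr.
have lt_qs : q < size s by apply: leq_ltn_trans lt_j.
have lt_iq : i.+1 < q < size s by rewrite lt_q.
apply: (Rtrans i q); first by apply: Rjump; rewrite ?sq.
apply: (IHn (j - q)) => //; first by rewrite -def_n ltn_sub2l // ltnW.
  by rewrite le_qj.
move=> z Xz; rewrite -eq_ij //.
have := side_chord z s2y lt_iq (erefl y) sq; rewrite (side_next x0) // -/y.
have [_ | neq_yz] /= := eqVneq y z; last rewrite (negPf (indepX _ _ Xy Xz neq_yz)).
  by case: (side s z i); case: (side s z q).
by case: (side s z i); case: (side s z q).
Qed.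

Lemma prec_chord s1 s2 s3 u :
  count_mem u (s1 ++ (u :: s2) ++ u :: s3) = 2 ->
  occ s2 u = false /\
  forall x, u != x -> prec (s1 ++ (u :: s2) ++ u :: s3) u x = occ s2 x.
Proof.
rewrite !count_cat /= eqxx /= !add1n addSn !addnS => -[/eqP].
rewrite !addn_eq0 => /and3P[/eqP u1 /eqP u2 /eqP u3].
split=> [|x ux]; first by rewrite /occ u2.
rewrite !prec_cat /= !prec_cat /= eqxx !prec_notin // !(occ_cat, occ_cons).
have [-> ->] : occ s1 u = false /\ occ s2 u = false by rewrite /occ u1 u2.
by rewrite (negPf ux); case: (occ s2 x); case: (occ s3 x).
Qed.

(** The cross terms with [s1] and [s2] depend on the replaced factor through its letter parities
    only. *)
Lemma prec_context s1 s2 t t' y x :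
  occ t' =1 occ t ->
  prec (s1 ++ t' ++ s2) y x =
  prec (s1 ++ t ++ s2) y x (+) (prec t' y x (+) prec t y x).
Proof.
move=> eq_occ; rewrite !prec_cat !occ_cat !eq_occ.
case: (prec t' y x); case: (prec t y x); case: (prec s1 y x);
  case: (prec s2 y x); case: (occ s1 y); case: (occ s2 x);
  by case: (occ t y); case: (occ t x).
Qed.

(** Reversal exchanges the two orders inside [s2], and [prec_sym] evaluates the difference. If [u]
    is the chord around [s2], the letters odd in [s2] are its neighbours: this is local
    complementation. *)
Lemma prec_reverse s1 s2 s3 u y x : y != x ->
  prec (s1 ++ (u :: rev s2) ++ u :: s3) y x =
  prec (s1 ++ (u :: s2) ++ u :: s3) y x (+) (occ s2 x && occ s2 y).
Proof.
move=> neq_yx; rewrite (@prec_context _ _ (u :: s2)) => [|z].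
  rewrite -(prec_sym s2 neq_yx) /= prec_rev occ_rev.
  case: (prec s2 y x); case: (prec s2 x y); by case: (_ && _).
by rewrite !occ_cons occ_rev.
Qed.

(** If [s1], [s3] begin with [u] and [s2], [s4] with [v], the sums of parities over [s1], [s2] and
    over [s2], [s3] are the closed neighbourhoods of [u] and [v]; the correction is then that of a
    pivot on [u], [v]. *)
Lemma prec_swap s0 s1 s2 s3 s4 y x :
  prec (s0 ++ s3 ++ s2 ++ s1 ++ s4) y x =
  prec (s0 ++ s1 ++ s2 ++ s3 ++ s4) y x
    (+) ((occ s1 x (+) occ s2 x) && (occ s2 y (+) occ s3 y))
    (+) ((occ s2 x (+) occ s3 x) && (occ s1 y (+) occ s2 y)).
Proof.
have cat3 t t' : s0 ++ t ++ s2 ++ t' ++ s4 = s0 ++ (t ++ s2 ++ t') ++ s4.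
  by rewrite -!catA.
rewrite !cat3 (@prec_context _ _ (s1 ++ s2 ++ s3)) => [|z]; last first.
  by rewrite !occ_cat; case: (occ s1 z); case: (occ s2 z); case: (occ s3 z).
rewrite -addbA; congr (_ (+) _); rewrite !prec_cat !occ_cat.
case: (prec s1 y x); case: (prec s2 y x); case: (prec s3 y x);
  case: (occ s1 y); case: (occ s2 y); case: (occ s3 y);
  by case: (occ s1 x); case: (occ s2 x); case: (occ s3 x).
Qed.

End Words.

(** * Pairings of edge-ends and passages of a tour *)

Section Passages.
Variable U : finType.
Implicit Types (a b c d x y z t : U) (P Q A : {set U}) (M T : {set {set U}}).

Definition pairing M A : Prop := partition M A /\ {in M, forall P, #|P| = 2}.

(** The block of [c] or of [d] avoids [{a, b}] and has two elements, so it can only be [{c, d}]. *)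
Lemma pairing_eq_cons a b c d M :
    uniq [:: a; b; c; d] -> pairing M [set a; b; c; d] -> [set a; b] \in M ->
  M = [set [set a; b]; [set c; d]].
Proof.
rewrite /= !inE !negb_or andbT => /and3P[/and3P[ab ac ad] /andP[bc bd] cd].
case=> /and3P[/eqP covM trivM M0] M2 abM.
have in_cov x : (x \in cover M) = [|| x == a, x == b, x == c | x == d].
  by rewrite covM !inE !orbA.
have cd_M x : x \in [set c; d] -> pblock M x = [set c; d].
  move=> x_cd; have x_cov : x \in cover M.
    by rewrite in_cov; move: x_cd; rewrite !inE => ->; rewrite !orbT.
  have xM := pblock_mem x_cov.
  have neq : pblock M x != [set a; b].
    apply: contraL x_cd => /eqP def_x; have := x_cov.
    rewrite -mem_pblock def_x !inE => /orP[]/eqP->;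
      by rewrite negb_or ?ac ?ad ?bc ?bd.
  have /pred0P dis := trivIsetP trivM _ _ xM abM neq.
  apply/eqP; rewrite eqEcard (M2 _ xM) cards2 cd andbT; apply/subsetP=> y yx.
  have := dis y; rewrite /= yx /= !inE => /negbT; rewrite negb_or => /andP[ya yb].
  have: y \in cover M by apply/bigcupP; exists (pblock M x).
  by rewrite in_cov (negPf ya) (negPf yb).
apply/setP=> P; rewrite !inE; apply/idP/orP=> [PM | [] /eqP-> //]; last first.
  have c_cd : c \in [set c; d] by rewrite !inE eqxx.
  by rewrite -(cd_M c) // pblock_mem // in_cov eqxx !orbT.
have [x xP] : exists x, x \in P by apply/set0Pn; apply: contraNneq M0 => <-.
have: x \in cover M by apply/bigcupP; exists P.
rewrite -(def_pblock trivM PM xP) in_cov orbA.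
case/orP=> [x_ab | x_cd]; first by left; rewrite (def_pblock trivM abM) // !inE.
by right; rewrite cd_M // !inE.
Qed.

Lemma set2_eqE x y z t :
  ([set x; y] == [set z; t]) =
  (x == z) && (y == t) || (x == t) && (y == z) :> bool.
Proof.
apply/eqP/idP => [/setP eq_s | ]; last first.
  by case/orP=> /andP[/eqP-> /eqP->] //; rewrite setUC.
move: (eq_s x) (eq_s y) (eq_s z) (eq_s t); rewrite !inE !eqxx /= ?orbT.
rewrite (eq_sym z x) (eq_sym z y) (eq_sym t x) (eq_sym t y).
by case: (x == z); case: (x == t); case: (y == z); case: (y == t) => //= _ _ <-.
Qed.

Lemma pairing_trichotomy a b c d M :
    uniq [:: a; b; c; d] -> pairing M [set a; b; c; d] ->
  [\/ M = [set [set a; b]; [set c; d]],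
      M = [set [set a; c]; [set b; d]] | M = [set [set a; d]; [set b; c]]].
Proof.
move=> Uabcd prM; have [/and3P[/eqP covM trivM M0] M2] := prM.
have a_cov : a \in cover M by rewrite covM !inE eqxx.
have aM := pblock_mem a_cov.
have : #|pblock M a :\ a| = 1.
  by have := cardsD1 a (pblock M a); rewrite mem_pblock a_cov M2 // => -[].
case/eqP/cards1P=> y def_y.
have def_a : pblock M a = [set a; y] by rewrite -def_y setD1K ?mem_pblock.
have : y \in cover M.
  by apply/bigcupP; exists (pblock M a); rewrite // def_a !inE eqxx orbT.
have neq_ya : y != a by have := set11 y; rewrite -def_y !inE => /andP[].
rewrite covM !inE (negPf neq_ya) /= -orbA => y_bcd.
move: aM; rewrite def_a; case/or3P: y_bcd => /eqP-> yM.
- by constructor 1; apply: pairing_eq_cons.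
- constructor 2; apply: pairing_eq_cons => //; last by rewrite (setUAC [set a]).
  rewrite (@perm_uniq _ _ [:: a; b; c; d]) // perm_cons.
  by rewrite (perm_catCA [:: c] [:: b] [:: d]).
constructor 3; apply: pairing_eq_cons => //; last by rewrite (setUAC [set a]) (setUAC
  (_ :|: _)).
rewrite (@perm_uniq _ _ [:: a; b; c; d]) // perm_cons.
by rewrite (perm_catC [:: d] [:: b; c]).
Qed.

(** The three pairings of four elements, tabulated as Booleans so that later arguments become case
    checks. *)
Lemma pairing_mem a b c d M :
    uniq [:: a; b; c; d] -> pairing M [set a; b; c; d] ->
  [/\ ([set c; d] \in M) = ([set a; b] \in M),
      ([set b; d] \in M) = ([set a; c] \in M),
      ([set b; c] \in M) = ([set a; d] \in M)
    & (([set a; b] \in M), ([set a; c] \in M), ([set a; d] \in M)) \in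
      [:: (true, false, false); (false, true, false); (false, false, true)]].
Proof.
move=> Uabcd prM; have := Uabcd.
rewrite /= !inE !negb_or andbT => /and3P[/and3P[ab ac ad] /andP[bc bd] cd].
have [ba ca da] : [/\ b != a, c != a & d != a] by split; rewrite eq_sym.
have [cb db dc] : [/\ c != b, d != b & d != c] by split; rewrite eq_sym.
have neqE := (negPf ab, negPf ac, negPf ad, negPf bc, negPf bd, negPf cd,
              negPf ba, negPf ca, negPf da, negPf cb, negPf db, negPf dc).
have [->|->|->] := pairing_trichotomy Uabcd prM;
  by split; rewrite !(inE, set2_eqE) !eqxx !neqE.
Qed.

Implicit Types (p q : U * U) (l : seq (U * U)).

Definition flip p : U * U := (p.2, p.1).

Definition pairs_of l : {set {set U}} := [set [set p.1; p.2] | p in l].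

(** For [l] the passages at a vertex, first components are entering ends; with [M] the transitions
    there, this is blackness. *)
Definition aligned M l : bool := [exists P in M, [set p.1 | p in l] \subset P].

Lemma perm_pairs_of l1 l2 : perm_eq l1 l2 -> pairs_of l1 = pairs_of l2.
Proof. move=> /perm_mem eq_l; apply/setP=> P.
by apply/imsetP/imsetP=> -[p pl ->]; exists p; rewrite // ?eq_l // -eq_l. Qed.
End Passages.

(** * The passages of an Euler tour *)

Section Tours.
Variable Gam : mgraph.
Implicit Types (u v : vert Gam) (d e x : edge_end Gam) (w s : seq (edge_end Gam)).

Lemma oppK : involutive (@opp Gam).
Proof. by case=> e b; rewrite /opp /= negbK. Qed.

Lemma opp_neq d : opp d != d.
Proof. by case: d => e []; rewrite /opp xpair_eqE andbF. Qed.

(* The pair (h, k) stands for entering a vertex by h and leaving it by k. *)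
Definition passage d e : edge_end Gam * edge_end Gam := (opp d, e).

(** Starting from the last item of [w] adds the closing passage, so that the list describes the
    cyclic trail. *)
Definition passes w := if w is d :: s then pairmap passage (last d s) w else [::].

Definition pass_at w u := [seq p <- passes w | att p.1 == u].

Lemma passesE d w : passes w = pairmap passage (last d w) w.
Proof. by case: w. Qed.

Lemma unzip2_passes w : unzip2 (passes w) = w.
Proof.
case: w => // d s; rewrite /passes.
by elim: (d :: s) (last d s) => //= e s' IHs x; rewrite IHs.
Qed.

Lemma unzip1_passes w : perm_eq (unzip1 (passes w)) (map (@opp Gam) w).
Proof.
case: w => // d s; rewrite /passes.
have -> r (x : edge_end Gam) : unzip1 (pairmap passage x r) = map (@opp Gam) (belast
  x r).
  by elim: r x => //= e r IHr x; rewrite IHr.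
by apply: perm_map; rewrite /= [d :: s]lastI perm_sym perm_rcons.
Qed.

Lemma cycle_passes w :
  path.cycle (fun d d' => att (opp d) == att d') w =
  all (fun p => att p.1 == att p.2) (passes w).
Proof.
case: w => // d s; rewrite (cycle_path d) (passesE d).
by elim: (d :: s) (last d (d :: s)) => //= e r IHr x; rewrite IHr.
Qed.

(** The list of passages begins with the closing one, which the other list has at its end; a
    rotation by one aligns them. *)
Lemma passes_next w : uniq w -> perm_eq (passes w) [seq (opp d, next w d) | d <- w].
Proof.
case: w => // d s Uw; rewrite -(perm_rot 1) /passes /= rot1_cons.
suff -> : rcons (pairmap passage d s) (passage (last d s) d) =
    [seq (opp x, next (d :: s) x) | x <- d :: s] by [].
have <- : pairmap passage d (rcons s d) =
    rcons (pairmap passage d s) (passage (last d s) d).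
  by rewrite -!cats1 pairmap_cat.
apply: (@eq_from_nth _ (d, d)).
  by rewrite size_pairmap size_rcons size_map.
move=> i; rewrite size_pairmap size_rcons => lt_i.
rewrite (nth_pairmap d) ?size_rcons // (nth_map d) // /passage.
rewrite next_nth mem_nth // index_uniq // -rcons_cons !nth_rcons lt_i.
(* At the last index the default value of [nth] in [next] is the head [d], which is the
   wrap-around. *)
congr (_, _); rewrite ltnS leq_eqVlt in lt_i; case/predU1P: lt_i => [-> | lt_i].
  by rewrite ltnn eqxx nth_default.
by rewrite lt_i.
Qed.

Lemma tour_pairsE w u : uniq w -> tour_pairs w u = pairs_of (pass_at w u).
Proof.
move=> Uw; have /perm_pairs_of -> : perm_eq (pass_at w u)
    [seq p <- [seq (opp d, next w d) | d <- w] | att p.1 == u].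
  exact/perm_filter/passes_next.
apply/setP=> P; apply/imsetP/imsetP=> -[].
  move=> d; rewrite inE => /andP[dw du] ->; exists (opp d, next w d) => //.
  by rewrite mem_filter du /=; apply: map_f.
move=> p; rewrite mem_filter => /andP[pu /mapP[d dw def_p]] ->; exists d.
  by rewrite inE dw; rewrite def_p in pu.
by rewrite def_p.
Qed.

Lemma entering_endsE w u : entering_ends w u = [set p.1 | p in pass_at w u].
Proof.
apply/setP=> h; apply/imsetP/imsetP=> -[].
  move=> d; rewrite inE => /andP[dw du] ->.
  have : opp d \in unzip1 (passes w) by rewrite (perm_mem (unzip1_passes w)) map_f.
  by case/mapP=> p pw def_p; exists p; rewrite // mem_filter -def_p du.
move=> p; rewrite mem_filter => /andP[pu pw] ->.
have : p.1 \in unzip1 (passes w) by apply: map_f.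
rewrite (perm_mem (unzip1_passes w)) => /mapP[d dw def_p].
by exists d; rewrite // inE dw -def_p.
Qed.

Lemma tour_blackE T w u : tour_black T w u = aligned (T u) (pass_at w u).
Proof. by rewrite /tour_black entering_endsE. Qed.

Lemma uniq_map_inj (A B : eqType) (f : A -> B) (r : seq A) :
  uniq (map f r) -> {in r &, injective f}.
Proof.
elim: r => //= a r IHr /andP[fa Ur] x y.
rewrite !inE => /predU1P[-> | xr] /predU1P[-> | yr] // eq_f.
- by rewrite eq_f map_f in fa.
- by rewrite -eq_f map_f in fa.
exact: IHr.
Qed.

Lemma split_count (A : Type) (a : pred A) (r : seq A) n :
  count a r = n.+1 -> exists r1 z r2, [/\ r = r1 ++ z :: r2, a z & count a r2 = n].
Proof.
elim: r => //= z r IHr; have [az [] ra | _ /IHr[r1 [z' [r2 [-> az' ra]]]]] := boolP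
  (a z).
  by exists [::], z, r.
by exists (z :: r1), z', r2.
Qed.

Lemma euler_tour_uniq w : euler_tour w -> uniq w.
Proof. by case=> /map_uniq. Qed.

Lemma passes_att w : euler_tour w -> all (fun p => att p.1 == att p.2) (passes w).
Proof. by case=> _ _; rewrite cycle_passes. Qed.

(** Each edge is traversed once, leaving by one of its ends and entering by the opposite one, so
    every edge-end is used exactly once in one of the two roles. *)
Lemma unzip_passes w : euler_tour w ->
  perm_eq (unzip1 (passes w) ++ unzip2 (passes w)) (enum {: edge_end Gam}).
Proof.
move=> Ew; have [Uw1 allw _] := Ew; have Uw := euler_tour_uniq Ew.
rewrite unzip2_passes; apply: uniq_perm; last 1 first.
- move=> d; rewrite mem_enum mem_cat (perm_mem (unzip1_passes w)).
  case/mapP: (allw d.1) => e ew def_d.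
  have [eq2 | neq2] := eqVneq d.2 e.2.
    suff -> : d = e by rewrite ew orbT.
    by case: d e def_d eq2 {ew} => ? ? [? ?] /= -> ->.
  suff -> : d = opp e by rewrite map_f.
  case: d e def_d neq2 {ew} => e' b' [? b] /= ->; rewrite /opp /=.
  by case: b b' => -[].
- rewrite cat_uniq (perm_uniq (unzip1_passes w)) map_inj_uniq ?Uw ?andbT //=.
    rewrite (eq_has (perm_mem (unzip1_passes w))).
    apply/hasP=> -[d dw /mapP[e ew def_d]].
    suff eq_de : d = e by move: (opp_neq e); rewrite -{2}eq_de def_d eqxx.
    by apply: (uniq_map_inj Uw1); rewrite // def_d.
  exact: (can_inj oppK).
exact: enum_uniq.
Qed.

Lemma size_pass_at w u : euler_tour w -> size (pass_at w u) = count_mem u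
  (tour_vertices w).
Proof.
move=> Ew; rewrite size_filter /tour_vertices count_map -{2}(unzip2_passes w).
rewrite count_map; apply: eq_in_count => p /(allP (passes_att Ew)) /= /eqP-> //.
Qed.

(** The ends at [u] are its entering and leaving ends, as many of one kind as of the other; four
    ends make two passages. *)
Lemma pass_at_four w u : four_regular Gam -> euler_tour w ->
  exists a b c d, [/\ pass_at w u = [:: (a, b); (c, d)], uniq [:: a; b; c; d]
                    & ends_at u = [set a; b; c; d]].
Proof.
move=> reg4 Ew; have perm_ends := unzip_passes Ew.
have att2 : [seq p <- passes w | att p.2 == u] = pass_at w u.
  by apply: eq_in_filter => p /(allP (passes_att Ew)) /eqP->.
have at_u : perm_eq (unzip1 (pass_at w u) ++ unzip2 (pass_at w u))
    (enum (ends_at u)).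
  have -> : unzip1 (pass_at w u) = [seq h <- unzip1 (passes w) | att h == u].
    by rewrite filter_map.
  have -> : unzip2 (pass_at w u) = [seq h <- unzip2 (passes w) | att h == u].
    by rewrite filter_map -att2.
  rewrite -filter_cat (perm_trans (perm_filter _ perm_ends)) //.
  apply: uniq_perm => [||h]; [exact/filter_uniq/enum_uniq | exact: enum_uniq |].
  by rewrite mem_filter !mem_enum !inE andbT.
have Uu : uniq (unzip1 (pass_at w u) ++ unzip2 (pass_at w u)).
  by rewrite (perm_uniq at_u) enum_uniq.
have := perm_size at_u; rewrite -cardE reg4 size_cat !size_map addnn.
move: (perm_mem at_u) Uu; case: (pass_at w u) => [|[a b] [|[c d] [|? ?]]] //.
move=> mem_u Uu _; exists a, b, c, d; split=> //.
  rewrite (@perm_uniq _ _ [:: a; c; b; d]) // perm_cons.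
  by rewrite (perm_catCA [:: b] [:: c] [:: d]).
apply/setP=> h; rewrite -mem_enum -mem_u !inE -!orbA.
by congr (_ || _); rewrite orbCA.
Qed.

End Tours.

(** * Pivots of bicoloured graphs *)

Section Pivot.
Variable V : finType.
Implicit Types (G H : bigraph V) (u v x y : V).

(** A [bigraph] holds functions and proofs, so tour graphs and complemented graphs are compared
    extensionally. *)
Definition same_graph G H : Prop := adj G =2 adj H /\ black G =1 black H.

Lemma same_graph_lc G H u : same_graph G H -> same_graph (lc G u) (lc H u).
Proof.
move=> [eq_adj eq_black]; split=> [x y | x] /=.
  by rewrite /lc_adj !eq_adj.
by rewrite /lc_black !eq_black eq_adj.
Qed.

Lemma same_graph_lcs G H s : same_graph G H -> same_graph (lcs G s) (lcs H s).
Proof. by elim: s G H => //= u s IHs G H /(same_graph_lc u)/IHs. Qed.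

Lemma same_graph_trans G1 G2 G3 :
  same_graph G1 G2 -> same_graph G2 G3 -> same_graph G1 G3.
Proof.
move=> [eq_adj eq_black] [eq_adj' eq_black'].
by split=> [x y | x]; rewrite ?eq_adj ?eq_black.
Qed.

Definition closed_nbr G u x : bool := (x == u) || adj G u x.

Lemma closed_nbrE G u x : closed_nbr G u x = (u == x) (+) adj G u x.
Proof. by rewrite /closed_nbr eq_sym; case: eqVneq => [->|] //=; rewrite adj_irr. Qed.

(** With closed neighbourhoods one formula also covers the rows of [u] and [v], which exchange their
    other neighbours. Its symmetry in [u] and [v] accounts for [uvu] and [vuv] having the same
    effect on edges. *)
Definition pivot_adj G u v : rel V := fun x y =>
  adj G x y (+) (closed_nbr G u x && closed_nbr G v y)
            (+) (closed_nbr G v x && closed_nbr G u y).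

Lemma lcs_pivot_adj G u v : adj G u v -> adj (lcs G [:: u; v; u]) =2 pivot_adj G u v.
Proof.
move=> uv x y; have vu : adj G v u by rewrite adj_sym.
have neq_uv : u != v by apply: contraTneq uv => ->; rewrite adj_irr.
rewrite /= /lc_adj /= /lc_adj /= /lc_adj /pivot_adj /closed_nbr.
have [-> | neq_xy] /= := eqVneq x y.
  by rewrite !(adj_irr, addbF) addbC andbC addbb.
(* These implications record what each coincidence of [x] or [y] with [u] or [v] forces on the
   adjacencies; the identity then follows by exhausting Boolean values. *)
have xu : (x == u) ==> [&& ~~ adj G u x, adj G v x & adj G x y == adj G u y].
  by apply/implyP=> /eqP->; rewrite adj_irr vu eqxx.
have xv : (x == v) ==> [&& ~~ adj G v x, adj G u x & adj G x y == adj G v y].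
  by apply/implyP=> /eqP->; rewrite adj_irr uv eqxx.
have yu : (y == u) ==> [&& ~~ adj G u y, adj G v y & adj G x y == adj G u x].
  by apply/implyP=> /eqP->; rewrite adj_irr vu adj_sym eqxx.
have yv : (y == v) ==> [&& ~~ adj G v y, adj G u y & adj G x y == adj G v x].
  by apply/implyP=> /eqP->; rewrite adj_irr uv adj_sym eqxx.
have xuy : ~~ ((x == u) && (y == u)).
  by apply: contra neq_xy => /andP[/eqP-> /eqP->].
have xvy : ~~ ((x == v) && (y == v)).
  by apply: contra neq_xy => /andP[/eqP-> /eqP->].
have xuv : ~~ ((x == u) && (x == v)).
  by apply: contra neq_uv => /andP[/eqP<- /eqP<-].
have yuv : ~~ ((y == u) && (y == v)).
  by apply: contra neq_uv => /andP[/eqP<- /eqP<-].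
rewrite ?adj_irr ?uv ?vu ?(eq_sym u x) ?(eq_sym u y) ?(eq_sym v x) ?(eq_sym v y).
rewrite ?(eq_sym v u) ?(negPf neq_uv) ?neq_uv ?eqxx ?(negPf neq_xy) ?neq_xy /=.
move: xu xv yu yv xuy xvy xuv yuv.
case: (x == u); case: (x == v); case: (y == u); case: (y == v) => //=;
  case: (adj G x y); case: (adj G u x); case: (adj G v x);
  by case: (adj G u y); case: (adj G v y).
Qed.

Lemma lcs_pivot_black G u v :
  adj G u v -> black G u -> black G v -> black (lcs G [:: u; v; u]) =1 black G.
Proof.
move=> uv bu bv x; rewrite /= /lc_black /= /lc_black /= /lc_black.
by rewrite !(bu, bv).
Qed.

Lemma pivot_adj_irr G u v : irreflexive (pivot_adj G u v).
Proof. by move=> x; rewrite /pivot_adj adj_irr andbC addbb. Qed.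

Lemma pivot_adjC G u v : pivot_adj G v u =2 pivot_adj G u v.
Proof. by move=> x y; rewrite /pivot_adj addbAC. Qed.

End Pivot.

(** * The two passages at a vertex against its transitions *)

Section Crossings.
Variable U : finType.
Implicit Types (a b c d : U) (M : {set {set U}}) (l : seq (U * U)).

(** The local picture at a vertex of an orthogonal tour: [l] lists its two passages as pairs
    (entering end, leaving end), and [M] pairs the same four ends differently. *)
Definition crossing M l : Prop :=
  [/\ size l = 2, uniq (unzip1 l ++ unzip2 l),
      pairing M [set h in unzip1 l ++ unzip2 l] & [disjoint pairs_of l & M]].

Lemma perm_crossing M l1 l2 : perm_eq l1 l2 -> crossing M l1 -> crossing M l2.
Proof.
move=> eq_l [sz Ul prM dis].
have eq_ends : perm_eq (unzip1 l1 ++ unzip2 l1) (unzip1 l2 ++ unzip2 l2).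
  by apply: perm_cat; apply: perm_map.
split; first by rewrite -(perm_size eq_l).
- by rewrite -(perm_uniq eq_ends).
- suff <- : [set h in unzip1 l1 ++ unzip2 l1] = [set h in unzip1 l2 ++ unzip2 l2].
    by [].
  by apply/setP=> h; rewrite !inE (perm_mem eq_ends).
by rewrite -(perm_pairs_of eq_l).
Qed.

Lemma perm_aligned M l1 l2 : perm_eq l1 l2 -> aligned M l1 = aligned M l2.
Proof.
move=> /perm_mem eq_l; rewrite /aligned.
suff -> : [set p.1 | p in l1] = [set p.1 | p in l2] by [].
by apply/setP=> h; apply/imsetP/imsetP=> -[p pl ->]; exists p;
  rewrite // ?eq_l // -eq_l.
Qed.

Lemma pairs_of2 a b c d :
  pairs_of [:: (a, b); (c, d)] = [set [set a; b]; [set c; d]].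
Proof.
apply/setP=> P; rewrite !inE; apply/imsetP/orP=> [[p] | [] /eqP->].
- by rewrite !inE => /orP[] /eqP-> -> /=; [left | right].
- by exists (a, b); rewrite ?inE ?eqxx.
by exists (c, d); rewrite ?inE ?eqxx ?orbT.
Qed.

Lemma aligned2 M a b c d : {in M, forall P : {set U}, #|P| = 2} -> a != c ->
  aligned M [:: (a, b); (c, d)] = ([set a; c] \in M).
Proof.
move=> M2 neq_ac; rewrite /aligned.
have -> : [set p.1 | p in [:: (a, b); (c, d)]] = [set a; c].
  apply/setP=> h; rewrite !inE; apply/imsetP/orP=> [[p] | [] /eqP->].
  - by rewrite !inE => /orP[] /eqP-> -> /=; [left | right].
  - by exists (a, b); rewrite ?inE ?eqxx.
  by exists (c, d); rewrite ?inE ?eqxx ?orbT.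
apply/existsP/idP=> [[P /andP[PM acP]] | acM].
  suff -> : [set a; c] = P by [].
  by apply/eqP; rewrite eqEcard acP (M2 _ PM) cards2 neq_ac.
by exists [set a; c]; rewrite acM /=.
Qed.

Lemma disjoint_set2 M (P Q : {set U}) :
  [disjoint [set P; Q] & M] = (P \notin M) && (Q \notin M).
Proof. by rewrite disjoints_subset subUset !sub1set !inE. Qed.

Lemma crossing2 M a b c d : crossing M [:: (a, b); (c, d)] ->
  [/\ uniq [:: a; b; c; d], pairing M [set a; b; c; d] & [set a; b] \notin M].
Proof.
case=> _ Ul prM; rewrite pairs_of2 disjoint_set2 => /andP[abM _]; split=> //.
  rewrite (@perm_uniq _ _ [:: a; c; b; d]) // perm_cons.
  by rewrite (perm_catCA [:: b] [:: c] [:: d]).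
suff <- : [set h in unzip1 [:: (a, b); (c, d)] ++ unzip2 [:: (a, b); (c, d)]] =
  [set a; b; c; d] by [].
by apply/setP=> h; rewrite !inE -!orbA; congr (_ || _); rewrite orbCA.
Qed.

Lemma pairs_of_flip l1 l2 : pairs_of (l1 ++ map (@flip U) l2) = pairs_of (l1 ++ l2).
Proof.
apply/setP=> P; apply/imsetP/imsetP=> -[p]; rewrite mem_cat => /orP[pl | pl] ->.
- by exists p; rewrite // mem_cat pl.
- case/mapP: pl => q ql ->; exists q; first by rewrite mem_cat ql orbT.
  by rewrite /= setUC.
- by exists p; rewrite // mem_cat pl.
exists (flip p); first by rewrite mem_cat map_f ?orbT.
by rewrite /= setUC.
Qed.

(** For passages [(a, b)] and [(c, d)], [M] contains exactly one of [{a, c}] and [{a, d}], which the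
    flip of one passage exchanges. Flipping both turns [{a, c}] into [{b, d}], and [M] contains both
    or neither. *)
Lemma aligned_flip M l1 l2 : crossing M (l1 ++ l2) ->
  aligned M (l1 ++ map (@flip U) l2) = aligned M (l1 ++ l2) (+) odd (size l2).
Proof.
case: l1 => [|[a b] [|[c d] [|? ?]]]; case: l2 => [|[a' b'] [|[c' d'] [|? ?]]];
  move=> cr; have [sz _ [_ M2] _] := cr; move: sz => // _.
- have [U4 prM abM] := crossing2 cr; have [_ bdM _ _] := pairing_mem U4 prM.
  move: U4; rewrite /= !inE !negb_or andbT => /and3P[/and3P[ab ac ad] /andP[bc bd]
    cd].
  by rewrite !aligned2 // bdM addbF.
- have [U4 prM abM] := crossing2 cr; have [_ _ _ mems] := pairing_mem U4 prM.
  move: U4; rewrite /= !inE !negb_or andbT => /and3P[/and3P[ab ac ad] /andP[bc bd]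
    cd].
  rewrite !aligned2 //; move: mems; rewrite (negPf abM) !inE.
  by case: (_ \in M); case: (_ \in M).
by rewrite addbF.
Qed.

(* In a crossing with end pairs ab and cd, the third pairing of its ends, besides
   those of the crossing and of M, is {ac, bd} if M is not aligned, and {ad, bc}
   otherwise. *)
Lemma crossing_white M a b c d :
    crossing M [:: (a, b); (c, d)] -> ~~ aligned M [:: (a, b); (c, d)] ->
  let l' := [:: (a, c); (b, d)] in
  [/\ [disjoint pairs_of l' & M], ~~ aligned M l'
    & pairs_of l' != pairs_of [:: (a, b); (c, d)]].
Proof.
move=> cr; have [_ _ [_ M2] _] := cr.
have [U4 prM abM] := crossing2 cr; have [_ bdM _ mems] := pairing_mem U4 prM.
move: U4; rewrite /= !inE !negb_or andbT => /and3P[/and3P[ab ac ad] /andP[bc bd] cd].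
rewrite !aligned2 // !pairs_of2 disjoint_set2 bdM => acM; rewrite acM abM; split=> //.
apply/eqP=> /setP/(_ [set a; c]).
by rewrite !inE !set2_eqE !eqxx /= (negPf ab) (negPf ac) (negPf ad) (eq_sym c b)
  (negPf bc).
Qed.

Lemma crossing_black M a b c d :
    crossing M [:: (a, b); (c, d)] -> aligned M [:: (a, b); (c, d)] ->
  let l' := [:: (a, d); (c, b)] in
  [disjoint pairs_of l' & M] /\ pairs_of l' != pairs_of [:: (a, b); (c, d)].
Proof.
move=> cr; have [_ _ [_ M2] _] := cr.
have [U4 prM abM] := crossing2 cr; have [_ _ bcM mems] := pairing_mem U4 prM.
move: U4; rewrite /= !inE !negb_or andbT => /and3P[/and3P[ab ac ad] /andP[bc bd] cd].
rewrite !aligned2 // !pairs_of2 disjoint_set2 => acM.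
rewrite [[set c; b]]setUC bcM; split.
  by move: mems; rewrite acM (negPf abM) !inE; case: (_ \in M).
apply/eqP=> /setP/(_ [set a; d]).
by rewrite !inE !set2_eqE !eqxx /= (negPf ab) (negPf ac) (negPf ad) (eq_sym d b)
  (negPf bd).
Qed.
End Crossings.

(** * Rerouting an orthogonal tour *)

Section Rerouting.
Variables (Gam : mgraph) (T : vert Gam -> {set {set edge_end Gam}}).
Hypotheses (reg4 : four_regular Gam) (trT : transition_system T).
Implicit Types (u v : vert Gam) (d e x y : edge_end Gam) (w s : seq (edge_end Gam)).
Implicit Types (X : {set vert Gam}).

Definition orthogonal_tour w : Prop := euler_tour w /\ orthogonal T (tour_pairs w).

Lemma pass_at_crossing w u : orthogonal_tour w -> crossing (T u) (pass_at w u).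
Proof.
case=> Ew orth; have [a [b [c [d [def_l Ul def_u]]]]] := pass_at_four u reg4 Ew.
have [parT T2] := trT u; rewrite /crossing -(tour_pairsE _ (euler_tour_uniq Ew))
  def_l.
split=> //.
- rewrite (@perm_uniq _ _ [:: a; b; c; d]) // perm_cons.
  by rewrite (perm_catCA [:: c] [:: b] [:: d]).
- suff -> : [set h in unzip1 [:: (a, b); (c, d)] ++ unzip2 [:: (a, b); (c, d)]] =
    ends_at u by [].
  rewrite def_u; apply/setP=> h; rewrite !inE -!orbA.
  by congr (_ || _); rewrite orbCA.
Qed.

Lemma count_tour_vertices w u : euler_tour w -> count_mem u (tour_vertices w) = 2.
Proof.
move=> Ew; rewrite -size_pass_at //.
by have [a [b [c [d [-> _ _]]]]] := pass_at_four u reg4 Ew.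
Qed.

Lemma tour_adjE w u v : euler_tour w ->
  tour_adj w u v = (u != v) && prec (tour_vertices w) u v.
Proof.
move=> Ew; rewrite /tour_adj; have [//| /= neq_uv] := eqVneq u v.
by rewrite interlacedE ?count_tour_vertices.
Qed.

Lemma split_tour_at w u : euler_tour w ->
  exists s1 d1 s2 d2 s3,
    [/\ w = s1 ++ (d1 :: s2) ++ d2 :: s3, att d1 = u & att d2 = u].
Proof.
move=> Ew; have := count_tour_vertices u Ew; rewrite count_map.
case/split_count=> s1 [d1 [s [-> /eqP at_d1]]].
by case/split_count=> s2 [d2 [s3 [-> /eqP at_d2 _]]]; exists s1, d1, s2, d2, s3.
Qed.

Definition rev_trail s := map (@opp Gam) (rev s).

Lemma pairmap_rev_trail x d s :
  pairmap (@passage Gam) x (rev_trail (d :: s)) =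
  (opp x, opp (last d s)) :: rev (map (@flip _) (pairmap (@passage Gam) d s)).
Proof.
elim: s x d => [|e s IHs] x d //=.
rewrite /rev_trail rev_cons map_rcons -cats1 pairmap_cat IHs /=.
have -> : last x (map (@opp Gam) (rev (e :: s))) = opp e.
  by rewrite rev_cons map_rcons last_rcons.
by rewrite rev_cons cats1 /passage /flip /= oppK.
Qed.

(** Reversing a section flips the passages inside it, keeps those outside, and reconnects only at
    its two extremities. *)
Lemma passes_reroute s1 d1 s2 d2 s3 :
  let inner := pairmap (@passage Gam) d1 s2 in
  exists x outer,
    perm_eq (passes (s1 ++ (d1 :: s2) ++ d2 :: s3))
      ([:: (opp x, d1); (opp (last d1 s2), d2)] ++ outer ++ inner) /\
    perm_eq (passes (s1 ++ rev_trail (d1 :: s2) ++ d2 :: s3))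
      ([:: (opp x, opp (last d1 s2)); (d1, d2)] ++ outer ++ map (@flip _) inner).
Proof.
(* [z] is the last item of the tour, so [last z s1] is the cyclic predecessor of [d1], even when
   [s1] is empty. *)
move=> inner; set z := last d2 s3; exists (last z s1).
exists (pairmap (@passage Gam) z s1 ++ pairmap (@passage Gam) d2 s3).
have lastE s : last d2 (s1 ++ s ++ d2 :: s3) = z by rewrite !last_cat.
rewrite !(passesE d2) !lastE !pairmap_cat pairmap_rev_trail /= -/inner.
have -> : last (last z s1) (rev_trail (d1 :: s2)) = opp d1.
  by rewrite /rev_trail rev_cons map_rcons last_rcons.
have -> : passage (opp d1) d2 = (d1, d2) by rewrite /passage oppK.
by split; apply/permP=> p; rewrite !count_cat /= !count_cat /= ?count_rev /passage;
  lia.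
Qed.

Lemma unzip2_pairmap x s : unzip2 (pairmap (@passage Gam) x s) = s.
Proof. by elim: s x => //= d s IHs x; rewrite IHs. Qed.

(** A reversed item starts where the original one ends, which is the start of the next original
    item; hence the shift by one. *)
Lemma tour_vertices_rev_trail d s :
    all (fun p => att p.1 == att p.2) (pairmap (@passage Gam) d s) ->
  tour_vertices (rev_trail (d :: s)) = att (opp (last d s)) :: rev (tour_vertices s).
Proof.
move=> att_s; rewrite /tour_vertices -{1}(unzip2_pairmap d (rev_trail _)).
rewrite pairmap_rev_trail /= /unzip2 !map_rev; congr (_ :: rev _).
rewrite -[in RHS](unzip2_pairmap d s) /unzip2 -!map_comp; apply/eq_in_map=> p.
by move/(allP att_s)=> /= /eqP.
Qed.

Lemma size_filter_pairmap v x s :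
    all (fun p => att p.1 == att p.2) (pairmap (@passage Gam) x s) ->
  odd (size [seq p <- pairmap (@passage Gam) x s | att p.1 == v]) =
  occ (tour_vertices s) v.
Proof.
move=> att_s; rewrite /occ size_filter /tour_vertices -{2}(unzip2_pairmap x s).
rewrite !count_map; congr odd; apply: eq_in_count => p.
by move/(allP att_s)=> /= /eqP->.
Qed.

Lemma tour_adj_split u v s1 d1 s2 d2 s3 :
    euler_tour (s1 ++ (d1 :: s2) ++ d2 :: s3) -> att d1 = u -> att d2 = u ->
  tour_adj (s1 ++ (d1 :: s2) ++ d2 :: s3) u v = occ (tour_vertices s2) v.
Proof.
move=> Ew at1 at2; have := count_tour_vertices u Ew; rewrite tour_adjE //.
rewrite /tour_vertices !map_cat /= at1 at2.
case/prec_chord=> s2u prec_u; have [<- | neq_uv] /= := eqVneq u v.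
  by rewrite s2u.
exact: prec_u.
Qed.

(** Reverse the section between the two passages at [u]. The new pairs at [u] form the third pairing
    of its ends, orthogonal because [u] is white; elsewhere passages are at most flipped, which
    keeps their pairs. *)
Lemma reroute_white w u :
    orthogonal_tour w -> white (tour_graph T w) u ->
  exists w', [/\ orthogonal_tour w',
    same_graph (tour_graph T w') (lc (tour_graph T w) u),
    forall v, v != u -> tour_pairs w' v = tour_pairs w v
  & tour_pairs w' u != tour_pairs w u].
Proof.
move=> Ow whu; have [Ew _] := Ow; have := whu; rewrite /white /= tour_blackE.
have [s1 [d1 [s2 [d2 [s3 [def_w at1 at2]]]]]] := split_tour_at u Ew.
have [x [outer []]] := passes_reroute s1 d1 s2 d2 s3.
rewrite -def_w; set inner := pairmap _ _ _; set w' := s1 ++ _; set y := last d1 s2.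
move=> pw pw'; have := passes_att Ew; rewrite (perm_all _ pw) /= all_cat.
rewrite at1 at2 => /and4P[/eqP atx /eqP aty att_o att_i] not_al.
have Ew' : euler_tour w'.
  have [Uw allw _] := Ew.
  have perm_w : perm_eq [seq d.1 | d <- w'] [seq d.1 | d <- w].
    rewrite def_w /w' !map_cat perm_cat2l perm_cat2r /rev_trail -map_comp.
    by rewrite map_rev perm_rev.
  split; first by rewrite (perm_uniq perm_w).
    by move=> e; rewrite (perm_mem perm_w).
  rewrite cycle_passes (perm_all _ pw') /= all_cat att_o all_map atx aty at1 at2.
  rewrite !eqxx /=; apply/allP=> p /(allP att_i) /=.
  by rewrite eq_sym.
(* The tours pass [u] only twice, so the remaining passages contribute nothing there. *)
have pass_u : perm_eq (pass_at w u) [:: (opp x, d1); (opp y, d2)] /\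
    perm_eq (pass_at w' u) [:: (opp x, opp y); (d1, d2)].
  have pu := perm_filter (fun p => att p.1 == u) pw.
  have pu' := perm_filter (fun p => att p.1 == u) pw'.
  move: pu pu'; rewrite /= atx aty at1 !eqxx => pu pu'.
  have := perm_size pu; rewrite (size_pass_at _ Ew) count_tour_vertices // =>
    -[/esym/size0nil nil_u].
  have := perm_size pu'; rewrite (size_pass_at _ Ew') count_tour_vertices // =>
    -[/esym/size0nil nil_u'].
  by rewrite nil_u in pu; rewrite nil_u' in pu'.
case: pass_u => pu pu'.
pose outer_at v := [seq p <- outer | att p.1 == v].
pose inner_at v := [seq p <- inner | att p.1 == v].
have pass_v v : v != u -> perm_eq (pass_at w v) (outer_at v ++ inner_at v) /\
    perm_eq (pass_at w' v) (outer_at v ++ map (@flip _) (inner_at v)).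
  rewrite eq_sym => /negPf neq_uv.
  have pv := perm_filter (fun p => att p.1 == v) pw.
  have pv' := perm_filter (fun p => att p.1 == v) pw'.
  move: pv pv'; rewrite /= atx aty at1 neq_uv !filter_cat filter_map => pv pv'.
  split=> //; rewrite (perm_trans pv') // perm_cat2l; apply: perm_map.
  rewrite (@eq_in_filter _ _ (fun p => att p.1 == v)) // => p /(allP att_i) /=.
  by move/eqP->.
have cr_u := perm_crossing pu (pass_at_crossing u Ow).
rewrite (perm_aligned _ pu) in not_al.
have [dis_u not_al' neq_u] := crossing_white cr_u not_al.
exists w'.
have pairs_v v : v != u -> tour_pairs w' v = tour_pairs w v.
  move=> /pass_v[pv pv']; rewrite !tour_pairsE ?euler_tour_uniq //.
  by rewrite (perm_pairs_of pv) (perm_pairs_of pv') pairs_of_flip.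
have pairs_u : tour_pairs w' u = pairs_of [:: (opp x, opp y); (d1, d2)].
  by rewrite tour_pairsE ?euler_tour_uniq ?(perm_pairs_of pu').
have adj_u v : tour_adj w u v = occ (tour_vertices s2) v.
  by rewrite def_w in Ew *; apply: tour_adj_split.
split=> //; last 1 first.
- by rewrite pairs_u tour_pairsE ?euler_tour_uniq ?(perm_pairs_of pu).
- split=> // v; have [-> | neq_vu] := eqVneq v u; first by rewrite pairs_u.
  by rewrite pairs_v //; have [_] := Ow.
split=> [v v' | v] /=.
  rewrite /lc_adj /= !adj_u !tour_adjE //; have [//| /= neq_vv'] := eqVneq v v'.
  rewrite {1}/w' def_w /tour_vertices !map_cat -!/(tour_vertices _).
  by rewrite tour_vertices_rev_trail // aty /= at1 at2 prec_reverse // andbC.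
have -> : lc_black (tour_graph T w) u v = tour_black T w v (+) tour_adj w u v.
  by rewrite /lc_black ifN.
rewrite !tour_blackE adj_u.
have [-> | neq_vu] := eqVneq v u.
  rewrite (perm_aligned _ pu) (perm_aligned _ pu') (negPf not_al) (negPf not_al').
  by rewrite -adj_u /tour_adj eqxx.
have [pv pv'] := pass_v v neq_vu.
(* As many passages at [v] are flipped as [s2] visits [v], an odd number exactly for the neighbours
   of [u]. *)
rewrite (perm_aligned _ pv) (perm_aligned _ pv') aligned_flip ?size_filter_pairmap //.
exact: perm_crossing pv (pass_at_crossing v Ow).
Qed.

(** One [v] lies between the two [u]; the other comes after both or before both. In the latter case
    the word starts with [v], whence the final disjunction. *)
Lemma split_tour_interlaced w u v : euler_tour w -> tour_adj w u v ->
  exists s0 a p b q c r d s,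
    [/\ w = s0 ++ (a :: p) ++ (b :: q) ++ (c :: r) ++ d :: s,
        att c = att a, att d = att b
      & att a = u /\ att b = v \/ att a = v /\ att b = u].
Proof.
move=> Ew; have [s1 [d1 [s2 [d2 [s3 [def_w at1 at2]]]]]] := split_tour_at u Ew.
have neq_uv : tour_adj w u v -> u == v = false by case/andP=> /negPf.
move=> adj_uv; have {}neq_uv := neq_uv adj_uv.
have := count_tour_vertices v Ew; move: adj_uv Ew; rewrite def_w => adj_uv Ew.
rewrite tour_adj_split // /occ in adj_uv.
rewrite /tour_vertices !map_cat /= !count_cat /= !count_cat /= at1 at2 neq_uv !add0n.
rewrite -!/(tour_vertices _).
have s2v : count_mem v (tour_vertices s2) <= 2 -> count_mem v (tour_vertices s2) = 1.
  by move: adj_uv; case: (count_mem v _) => [|[|[]]].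
move=> sum2; have {}s2v : count_mem v (tour_vertices s2) = 1.
  by apply: s2v; rewrite -sum2 addnCA leq_addr.
have [p [b [q [def_s2 /eqP atb _]]]] : exists p b q,
    [/\ s2 = p ++ b :: q, att b == v & count (fun d => att d == v) q = 0].
  by apply: split_count; rewrite -s2v count_map.
have [s3v | s3v] : count_mem v (tour_vertices s3) = 1 \/ count_mem v (tour_vertices
  s1) = 1.
  move: sum2; rewrite s2v; case: (count_mem v (tour_vertices s3)) => [|[|?]].
  - by rewrite addn0 addn1 => -[]; right.
  - by left.
  by rewrite !addnS.
  have [r [d [s [def_s3 /eqP atd _]]]] : exists r d s,
      [/\ s3 = r ++ d :: s, att d == v & count (fun d => att d == v) s = 0].
    by apply: split_count; rewrite -s3v count_map.
  exists s1, d1, p, b, q, d2, r, d, s; split; rewrite ?at1 ?at2 ?atb //; last by left.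
  by rewrite def_s2 def_s3 /= -catA.
have [s0 [a [s [def_s1 /eqP ata _]]]] : exists s0 a s,
    [/\ s1 = s0 ++ a :: s, att a == v & count (fun d => att d == v) s = 0].
  by apply: split_count; rewrite -s3v count_map.
exists s0, a, s, d1, p, b, q, d2, s3; split; rewrite ?ata ?at1 ?at2 //; last by right.
by rewrite def_s2 def_s1 -catA /= -catA.
Qed.

(** The sections [a :: p] and [c :: r] both lead from [att a] to [att b], so they can be exchanged.
    All edges keep their direction, hence all entering ends and colours; blackness makes the new
    pairs at both vertices orthogonal. *)
Lemma reroute_black_split s0 a p b q c r d s :
    let w := s0 ++ (a :: p) ++ (b :: q) ++ (c :: r) ++ d :: s in
    orthogonal_tour w -> att c = att a -> att d = att b ->
    black (tour_graph T w) (att a) -> black (tour_graph T w) (att b) ->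
    att a != att b ->
  exists w', [/\ orthogonal_tour w',
    tour_adj w' =2 pivot_adj (tour_graph T w) (att a) (att b),
    tour_black T w' =1 tour_black T w,
    forall z, z != att a -> z != att b -> tour_pairs w' z = tour_pairs w z
  & (tour_pairs w' (att a) != tour_pairs w (att a)) &&
    (tour_pairs w' (att b) != tour_pairs w (att b))].
Proof.
move=> w Ow atc atd; have [Ew _] := Ow.
rewrite /= !tour_blackE => bl_u bl_v neq_uv.
pose w' := s0 ++ (c :: r) ++ (b :: q) ++ (a :: p) ++ d :: s.
have perm_w : perm_eq w' w.
  by apply/permP=> P; rewrite /w /w'; do 4?rewrite !count_cat /=; lia.
pose x := last (last d s) s0.
pose outer := pairmap (@passage Gam) (last d s) s0 ++ pairmap (@passage Gam) a p ++
  pairmap (@passage Gam) b q ++ pairmap (@passage Gam) c r ++ pairmap (@passage Gam)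
    d s.
have pw : perm_eq (passes w) ([:: (opp x, a); (opp (last b q), c)] ++
    [:: (opp (last a p), b); (opp (last c r), d)] ++ outer).
  rewrite (passesE d) /w !last_cat !pairmap_cat /=; apply/permP=> P.
  by rewrite /outer; do 4?rewrite !count_cat /=; rewrite /passage /x; lia.
have pw' : perm_eq (passes w') ([:: (opp x, c); (opp (last b q), a)] ++
    [:: (opp (last a p), d); (opp (last c r), b)] ++ outer).
  rewrite (passesE d) /w' !last_cat !pairmap_cat /=; apply/permP=> P.
  by rewrite /outer; do 4?rewrite !count_cat /=; rewrite /passage /x; lia.
have := passes_att Ew; rewrite (perm_all _ pw) /= atc atd.
case/and5P=> /eqP atx /eqP atlb /eqP atla /eqP atlc att_o.
have Ew' : euler_tour w'.
  have [Uw allw _] := Ew.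
  have perm_w1 : perm_eq [seq d.1 | d <- w'] [seq d.1 | d <- w] by apply: perm_map.
  split; first by rewrite (perm_uniq perm_w1).
    by move=> e; rewrite (perm_mem perm_w1).
  by rewrite cycle_passes (perm_all _ pw') /= atx atlb atla atlc atc atd !eqxx.
have neq_vu : att b == att a = false by rewrite eq_sym (negPf neq_uv).
have pass_at2 v w1 l : euler_tour w1 -> size l = 2 ->
    perm_eq (pass_at w1 v) (l ++ [seq p <- outer | att p.1 == v]) ->
    perm_eq (pass_at w1 v) l.
  move=> Ew1 sz pv; have := perm_size pv.
  rewrite (size_pass_at _ Ew1) count_tour_vertices // size_cat sz => -[].
  by move/esym/size0nil => nil_v; rewrite nil_v cats0 in pv.
have pu : perm_eq (pass_at w (att a)) [:: (opp x, a); (opp (last b q), c)].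
  apply: pass_at2 => //; have := perm_filter (fun p => att p.1 == att a) pw.
  by rewrite /= atx atlb atla atlc eqxx neq_vu.
have pu' : perm_eq (pass_at w' (att a)) [:: (opp x, c); (opp (last b q), a)].
  apply: pass_at2 => //; have := perm_filter (fun p => att p.1 == att a) pw'.
  by rewrite /= atx atlb atla atlc eqxx neq_vu.
have pv : perm_eq (pass_at w (att b)) [:: (opp (last a p), b); (opp (last c r), d)].
  apply: pass_at2 => //; have := perm_filter (fun p => att p.1 == att b) pw.
  by rewrite /= atx atlb atla atlc eqxx (negPf neq_uv).
have pv' : perm_eq (pass_at w' (att b)) [:: (opp (last a p), d); (opp (last c r), b)].
  apply: pass_at2 => //; have := perm_filter (fun p => att p.1 == att b) pw'.
  by rewrite /= atx atlb atla atlc eqxx (negPf neq_uv).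
have pairs_z z : z != att a -> z != att b -> tour_pairs w' z = tour_pairs w z.
  rewrite ![z == _]eq_sym => /negPf neq_uz /negPf neq_vz.
  rewrite !tour_pairsE ?euler_tour_uniq //; apply: perm_pairs_of.
  have pz := perm_filter (fun p => att p.1 == z) pw.
  have pz' := perm_filter (fun p => att p.1 == z) pw'.
  move: pz pz'; rewrite /= atx atlb atla atlc neq_uz neq_vz => pz pz'.
  by rewrite (perm_trans pz') // perm_sym.
have [dis_u neq_u] : [disjoint tour_pairs w' (att a) & T (att a)] /\
    tour_pairs w' (att a) != tour_pairs w (att a).
  rewrite !tour_pairsE ?euler_tour_uniq // (perm_pairs_of pu) (perm_pairs_of pu').
  apply: crossing_black; first exact: perm_crossing pu (pass_at_crossing _ Ow).
  by rewrite -(perm_aligned _ pu).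
have [dis_v neq_v] : [disjoint tour_pairs w' (att b) & T (att b)] /\
    tour_pairs w' (att b) != tour_pairs w (att b).
  rewrite !tour_pairsE ?euler_tour_uniq // (perm_pairs_of pv) (perm_pairs_of pv').
  apply: crossing_black; first exact: perm_crossing pv (pass_at_crossing _ Ow).
  by rewrite -(perm_aligned _ pv).
exists w'; split=> //; last by rewrite neq_u.
- split=> // z; have [-> // | neq_zu] := eqVneq z (att a).
  have [-> // | neq_zv] := eqVneq z (att b); rewrite pairs_z //.
  by have [_] := Ow.
(* The items [a] and [b] themselves supply the vertex that closes each neighbourhood, which puts the
   sums in the form of [prec_swap]. *)
- have nbr_u z : closed_nbr (tour_graph T w) (att a) z =
      occ (tour_vertices (a :: p)) z (+) occ (tour_vertices (b :: q)) z.
    rewrite closed_nbrE (_ : adj _ _ z = occ (tour_vertices (p ++ b :: q)) z) /=.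
      by rewrite /tour_vertices map_cat occ_cat /= !occ_cons !addbA.
    have def_w : w = s0 ++ (a :: p ++ b :: q) ++ c :: (r ++ d :: s).
      by rewrite /w /= -catA.
    by rewrite /= def_w in Ew *; apply: tour_adj_split.
  have nbr_v z : closed_nbr (tour_graph T w) (att b) z =
      occ (tour_vertices (b :: q)) z (+) occ (tour_vertices (c :: r)) z.
    rewrite closed_nbrE (_ : adj _ _ z = occ (tour_vertices (q ++ c :: r)) z) /=.
      by rewrite /tour_vertices map_cat occ_cat /= !occ_cons !addbA.
    have def_w : w = (s0 ++ a :: p) ++ (b :: q ++ c :: r) ++ d :: s.
      by rewrite /w -catA /= -catA.
    by rewrite /= def_w in Ew *; apply: tour_adj_split.
  move=> z z'; have [<- | neq_zz'] := eqVneq z z'.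
    by rewrite pivot_adj_irr /tour_adj eqxx.
  rewrite /pivot_adj !nbr_u !nbr_v /= !tour_adjE // neq_zz' /=.
  rewrite /w' /w /tour_vertices !map_cat prec_swap -!/(tour_vertices _).
  move: (occ (tour_vertices (a :: p)) z) (occ (tour_vertices (a :: p)) z').
  move: (occ (tour_vertices (b :: q)) z) (occ (tour_vertices (b :: q)) z').
  move: (occ (tour_vertices (c :: r)) z) (occ (tour_vertices (c :: r)) z').
  move: (prec _ _ _) => [] [] [] [] [] [] [] //.
move=> z; rewrite /= /tour_black.
suff -> : entering_ends w' z = entering_ends w z by [].
apply/setP=> h; apply/imsetP/imsetP=> -[e]; rewrite inE => /andP[ew ez] ->;
  by exists e; rewrite // inE ez andbT ?(perm_mem perm_w) // -(perm_mem perm_w).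
Qed.

(** The split may meet [u] and [v] in either order, which is harmless because the pivot is symmetric
    in them. *)
Lemma reroute_black w u v :
    orthogonal_tour w -> adj (tour_graph T w) u v ->
    black (tour_graph T w) u -> black (tour_graph T w) v ->
  exists w', [/\ orthogonal_tour w',
    same_graph (tour_graph T w') (lcs (tour_graph T w) [:: u; v; u]),
    forall z, z != u -> z != v -> tour_pairs w' z = tour_pairs w z,
    tour_pairs w' u != tour_pairs w u & tour_pairs w' v != tour_pairs w v].
Proof.
move=> Ow adj_uv bu bv; have [Ew _] := Ow.
have neq_uv : u != v by case/andP: adj_uv.
have [s0 [a [p [b [q [c [r [d [s [def_w atc atd atab]]]]]]]]]] :=
  split_tour_interlaced Ew adj_uv.
have [w' [Ow' adj_w' black_w' pairs_w' /andP[neq_a neq_b]]] : exists w',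
  [/\ orthogonal_tour w',
    tour_adj w' =2 pivot_adj (tour_graph T w) (att a) (att b),
    tour_black T w' =1 tour_black T w,
    forall z, z != att a -> z != att b -> tour_pairs w' z = tour_pairs w z
  & (tour_pairs w' (att a) != tour_pairs w (att a)) &&
    (tour_pairs w' (att b) != tour_pairs w (att b))].
  rewrite def_w in Ow bu bv *.
  by apply: reroute_black_split => //; case: atab => -[ata atb];
    rewrite ?ata ?atb // eq_sym.
exists w'; split=> //.
- split=> [x y | x]; last by rewrite lcs_pivot_black //; apply: black_w'.
  rewrite lcs_pivot_adj // [LHS]adj_w'; case: atab => -[-> ->] //.
  exact: pivot_adjC.
- by move=> z zu zv; apply: pairs_w'; case: atab => -[ata atb]; rewrite ?ata ?atb.
- by case: atab => -[ata atb]; rewrite -?ata -?atb.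
by case: atab => -[ata atb]; rewrite -?ata -?atb.
Qed.

Lemma admissible_tour w (s : seq (vert Gam)) : orthogonal_tour w -> admissible
  (tour_graph T w) s ->
  exists2 w', orthogonal_tour w' & same_graph (tour_graph T w') (lcs (tour_graph T w)
    s).
Proof.
move=> Ow; elim=> {s} [|s u _ [w' Ow' [eq_adj eq_black]] wh_u
  |s u v _ [w' Ow' [eq_adj eq_black]] adj_uv bu bv
  |s u v _ [w' Ow' [eq_adj eq_black]] adj_uv bu bv]; first by exists w.
- have [|w1 [Ow1 same_w1 _ _]] := @reroute_white w' u Ow';
  first by rewrite /white eq_black.
  exists w1 => //; apply: same_graph_trans same_w1 _.
  by rewrite /lcs foldl_cat; apply: same_graph_lc.
- have [|||w1 [Ow1 same_w1 _ _ _]] := @reroute_black w' u v Ow';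
  rewrite ?eq_adj ?eq_black //.
  exists w1 => //; apply: same_graph_trans same_w1 _.
  by rewrite /lcs foldl_cat; apply: (@same_graph_lcs _ _ _ [:: _; _; _]).
(* The letters [vuv] are the same move with the two vertices exchanged. *)
have [|||w1 [Ow1 same_w1 _ _ _]] := @reroute_black w' v u Ow'.
- by rewrite eq_adj adj_sym.
- by rewrite eq_black.
- by rewrite eq_black.
exists w1 => //; apply: same_graph_trans same_w1 _.
by rewrite /lcs foldl_cat; apply: (@same_graph_lcs _ _ _ [:: _; _; _]).
Qed.

(** Four ends have three pairings. One is [T u] and one is [P], so only one is left for [Q] and
    [Q']; the tour serves to list the ends. *)
Lemma third_pairing u (P Q Q' : {set {set edge_end Gam}}) w : euler_tour w ->
    pairing P (ends_at u) -> [disjoint P & T u] ->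
    pairing Q (ends_at u) -> [disjoint Q & T u] ->
    pairing Q' (ends_at u) -> [disjoint Q' & T u] ->
  Q != P -> Q' != P -> Q = Q'.
Proof.
move=> Ew; have [a [b [c [d [_ U4 def_u]]]]] := pass_at_four u reg4 Ew.
have prT : pairing (T u) (ends_at u) by [].
have neqT (R : {set {set edge_end Gam}}) :
    pairing R (ends_at u) -> [disjoint R & T u] -> R <> T u.
  move=> [/and3P[/eqP covR _ _] _] /pred0P dis def_R.
  have : a \in cover (T u) by rewrite -def_R covR def_u !inE eqxx.
  case/bigcupP=> S ST _; have := dis S.
  by rewrite /= def_R ST.
move=> prP /(neqT _ prP) + prQ /(neqT _ prQ) + prQ' /(neqT _ prQ') + /eqP + /eqP.
rewrite def_u in prT prP prQ prQ'.
have [->|->|->] := pairing_trichotomy U4 prT;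
  have [->|->|->] := pairing_trichotomy U4 prP;
  have [->|->|->] := pairing_trichotomy U4 prQ;
  by have [->|->|->] := pairing_trichotomy U4 prQ'.
Qed.

Lemma tour_pairs_pairing u w :
  orthogonal_tour w -> pairing (tour_pairs w u) (ends_at u).
Proof.
case=> Ew _; have [a [b [c [d [def_l U4 def_u]]]]] := pass_at_four u reg4 Ew.
rewrite tour_pairsE ?euler_tour_uniq // def_l pairs_of2 def_u.
move: U4; rewrite /= !inE !negb_or andbT => /and3P[/and3P[ab ac ad] /andP[bc bd] cd].
split; last first.
  by move=> P; rewrite !inE => /orP[] /eqP->; rewrite cards2 ?ab ?cd.
have neqE := (negPf ab, negPf ac, negPf ad, negPf bc, negPf bd, negPf cd).
have neq_sets : [set a; b] != [set c; d] by rewrite set2_eqE !neqE.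
apply/and3P; split.
- by rewrite /cover bigcup_setU !big_set1 setUA.
- apply/trivIsetP=> A B; rewrite !inE.
  have dis : [disjoint [set a; b] & [set c; d]].
    by rewrite disjoints_subset subUset !sub1set !inE !neqE.
  case/orP=> /eqP-> /orP[] /eqP->; rewrite ?eqxx // => _.
  by rewrite disjoint_sym.
rewrite !inE negb_or ![set0 == _]eq_sym; apply/andP.
by split; apply/set0Pn; [exists a | exists c]; rewrite !inE eqxx.
Qed.

Definition differences (P : vert Gam -> {set {set edge_end Gam}}) w :=
  [set u | tour_pairs w u != P u].

(** Induction on the number of vertices where the tour differs from [P]: a white one among them, or
    two adjacent black ones, can be rerouted, which makes the tour agree with [P] there and changes
    no pairs elsewhere. *)
Lemma closest_tour (P : vert Gam -> {set {set edge_end Gam}}) w :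
    (forall u, pairing (P u) (ends_at u)) -> orthogonal T P -> orthogonal_tour w ->
  exists (s : seq (vert Gam)) w', [/\ admissible (tour_graph T w) s, orthogonal_tour
    w',
    same_graph (tour_graph T w') (lcs (tour_graph T w) s),
    {in differences P w', forall u, tour_black T w' u}
  & {in differences P w' &, forall u v, ~~ tour_adj w' u v}].
Proof.
move=> prP orthP Ow.
suff reach n (s : seq (vert Gam)) w' : #|differences P w'| = n -> admissible
  (tour_graph T w) s ->
    orthogonal_tour w' -> same_graph (tour_graph T w') (lcs (tour_graph T w) s) ->
    exists (s : seq (vert Gam)) w', [/\ admissible (tour_graph T w) s,
      orthogonal_tour w',
      same_graph (tour_graph T w') (lcs (tour_graph T w) s),
      {in differences P w', forall u, tour_black T w' u}
    & {in differences P w' &, forall u v, ~~ tour_adj w' u v}].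
  by apply: (reach _ [::] w) => //; apply: admissible_nil.
elim/ltn_ind: n s w' => n IHn s w' def_n adm Ow' same; have [eq_adj eq_black] := same.
(* Only two pairings at [u] are orthogonal to [T], so changing a wrong one yields that of [P]. *)
have fix_diff w1 u : orthogonal_tour w1 -> u \in differences P w' ->
    tour_pairs w1 u != tour_pairs w' u -> tour_pairs w1 u = P u.
  move=> Ow1; rewrite inE eq_sym => neq_P neq_w'.
  have [Ew' orth'] := Ow'; have [_ orth1] := Ow1.
  by apply: (third_pairing Ew' (tour_pairs_pairing u Ow')) neq_w' neq_P => //;
    apply: tour_pairs_pairing.
have [/existsP[u /andP[diff_u wh_u]] | no_white] :=
  boolP [exists u in differences P w', ~~ tour_black T w' u].
  have [w1 [Ow1 same1 pairs1 neq1]] := reroute_white Ow' wh_u.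
  apply: (IHn #|differences P w1| _ (s ++ [:: u]) w1) => //.
  - rewrite -def_n; apply/proper_card/properP.
    split; last by exists u; rewrite // inE fix_diff ?eqxx.
    apply/subsetP=> z; rewrite inE; have [-> | neq_zu] := eqVneq z u.
      by rewrite fix_diff ?eqxx.
    by rewrite pairs1 // inE.
  - by apply: admissible_white => //; rewrite /white -eq_black.
  by apply: same_graph_trans same1 _; rewrite /lcs foldl_cat; apply: same_graph_lc.
have black_diff : {in differences P w', forall u, tour_black T w' u}.
  move=> u diff_u; apply: contraR no_white => wh_u.
  by apply/existsP; exists u; rewrite diff_u.
have [/existsP[u /existsP[v /and3P[diff_u diff_v adj_uv]]] | no_adj] := boolP
    [exists u, exists v,
       [&& u \in differences P w', v \in differences P w' & tour_adj w' u v]].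
  have bu := black_diff u diff_u; have bv := black_diff v diff_v.
  have [w1 [Ow1 same1 pairs1 neq_u neq_v]] := reroute_black Ow' adj_uv bu bv.
  apply: (IHn #|differences P w1| _ (s ++ [:: u; v; u]) w1) => //.
  - rewrite -def_n; apply/proper_card/properP.
    split; last by exists u; rewrite // inE fix_diff ?eqxx.
    apply/subsetP=> z; rewrite inE; have [-> | neq_zu] := eqVneq z u.
      by rewrite fix_diff ?eqxx.
    have [-> | neq_zv] := eqVneq z v; first by rewrite fix_diff ?eqxx.
    by rewrite pairs1 // inE.
  - by apply: admissible_suvu; rewrite // -?eq_adj -?eq_black.
  apply: same_graph_trans same1 _; rewrite /lcs foldl_cat.
  exact: (@same_graph_lcs _ _ _ [:: _; _; _]).
exists s, w'; split=> // u v diff_u diff_v; apply: contra no_adj => adj_uv.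
by apply/existsP; exists u; apply/existsP; exists v; rewrite diff_u diff_v.
Qed.

End Rerouting.

(** * Regions cut out by the chords of a tour *)

Section Regions.
Variable Gam : mgraph.
Hypothesis reg4 : four_regular Gam.
Implicit Types (u v : vert Gam) (d e x y : edge_end Gam) (w s : seq (edge_end Gam)).
Implicit Types (X : {set vert Gam}).

(** An edge is placed on the circle at the position of its item, so both its ends get the same side
    of every chord. *)
Definition edge_side w (f : edge Gam) u : bool :=
  side (tour_vertices w) u (index f [seq d.1 | d <- w]).

Lemma edge_side_nth w d i u : euler_tour w -> i < size w ->
  edge_side w (nth d w i).1 u = side (tour_vertices w) u i.
Proof.
move=> [Uw _ _] lt_i; rewrite /edge_side.
have <- : nth d.1 [seq d.1 | d <- w] i = (nth d w i).1 by rewrite (nth_map d).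
by rewrite index_uniq ?size_map.
Qed.

(** A passage advances the position by one, and only the chord of the vertex passed is stepped
    over. *)
Lemma edge_side_passage w p u : euler_tour w -> p \in passes w ->
  edge_side w p.1.1 u = edge_side w p.2.1 u (+) (att p.2 == u).
Proof.
move=> Ew pw; set d := p.2; move: pw; rewrite (passesE d) => /(nthP (d, d))[i].
rewrite size_pairmap => lt_i; rewrite (nth_pairmap d) // /passage => def_p.
have sz : size (tour_vertices w) = size w by rewrite size_map.
have def_d : nth d w i = d by exact: (congr1 snd def_p).
have -> : edge_side w d.1 u = side (tour_vertices w) u i.
  by rewrite -def_d edge_side_nth.
have att_i : nth (att d) (tour_vertices w) i = att d.
  by rewrite /tour_vertices (nth_map d) ?def_d.
have -> : p.1 = opp (nth d (last d w :: w) i) by rewrite (congr1 fst (esym def_p)).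
case: i => [|i] /= in lt_i def_p def_d att_i *.
  (* The first passage comes from the last item, where the whole word has been read: [u] has
     occurred twice, so the side is that before the start. *)
  rewrite -nth_last edge_side_nth ?prednK // /side prednK // -{1}sz take_size.
  rewrite {1}/occ (count_tour_vertices reg4) // (take_nth (att d)) ?sz // take0 att_i.
  by rewrite /= occ_cons addbF addbb.
rewrite edge_side_nth ?(ltnW lt_i) // (side_next (att d)) ?sz // att_i.
by rewrite -addbA addbb addbF.
Qed.

(** This serves in both directions: a chord crossing [v] separates the two passages at [v], while a
    chord other than [v] that does not cross it fails to. *)
Lemma edge_side_chord w u v b d : euler_tour w ->
    b \in w -> d \in w -> b != d -> att b = v -> att d = v ->
  edge_side w b.1 u (+) edge_side w d.1 u = (v == u) || tour_adj w u v.
Proof.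
move=> Ew bw dw neq_bd atb atd.
have sz : size (tour_vertices w) = size w by rewrite size_map.
have nth_att i : i < size w -> nth v (tour_vertices w) i = att (nth b w i).
  by move=> lt_i; rewrite (nth_map b).
have lt_b : index b w < size w by rewrite index_mem.
have lt_d : index d w < size w by rewrite index_mem.
have chord p q : p < q < size w -> att (nth b w p) = v -> att (nth b w q) = v ->
    side (tour_vertices w) u p (+) side (tour_vertices w) u q = (v == u) || tour_adj
      w u v.
  move=> /andP[lt_pq lt_q] atp atq; have lt_p := ltn_trans lt_pq lt_q.
  rewrite (@side_chord _ v _ _ v) ?sz ?lt_pq ?nth_att ?count_tour_vertices //.
  rewrite (tour_adjE reg4) // [u == v]eq_sym; by case: (v == u).
rewrite -{1}(nth_index b bw) -{1}(nth_index b dw) !edge_side_nth //.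
case: (ltngtP (index b w) (index d w)) => [lt_bd | lt_db | eq_bd].
- by rewrite chord ?lt_bd ?nth_index.
- by rewrite addbC chord ?lt_db ?nth_index.
by rewrite -(nth_index b bw) eq_bd nth_index ?eqxx in neq_bd.
Qed.

(** A region of the disk cut by the chords of [X] is encoded by the set of chords on whose inner arc
    the edge lies. *)
Definition region w (X : {set vert Gam}) (f : edge Gam) := [set u in X | edge_side w
  f u].

Lemma eq_regionP w X f f' :
  reflect {in X, forall u, edge_side w f u = edge_side w f' u}
          (region w X f == region w X f').
Proof.
apply: (iffP eqP) => [/setP eq_r u Xu | eq_s].
  by have := eq_r u; rewrite !inE Xu.
by apply/setP=> u; rewrite !inE; case: (boolP (u \in X)) => //= /eq_s->.
Qed.

Lemma region_passage w X p : euler_tour w -> p \in passes w -> att p.2 \notin X ->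
  region w X p.1.1 = region w X p.2.1.
Proof.
move=> Ew pw notX; apply/eqP/eq_regionP=> u Xu.
rewrite edge_side_passage //; case: eqP => [def_u | _]; last by rewrite addbF.
by rewrite def_u Xu in notX.
Qed.

(** Entering along one passage and leaving along the other changes the side of the chord [v] twice;
    no other chord of [X] is affected, as none crosses [v]. *)
Lemma region_jump w X v p q : euler_tour w ->
    {in X &, forall u v, ~~ tour_adj w u v} -> v \in X ->
    p \in pass_at w v -> q \in pass_at w v -> p != q ->
  region w X p.1.1 = region w X q.2.1.
Proof.
move=> Ew indepX Xv pv qv neq_pq; apply/eqP/eq_regionP=> u Xu.
move: pv qv; rewrite !mem_filter => /andP[/eqP atp pw] /andP[/eqP atq qw].
have atp2 : att p.2 = v by have /eqP <- := allP (passes_att Ew) p pw.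
have atq2 : att q.2 = v by have /eqP <- := allP (passes_att Ew) q qw.
have Up2 : {in passes w &, injective snd}.
  by apply: uniq_map_inj; rewrite -/(unzip2 _) unzip2_passes euler_tour_uniq.
have mem2 r : r \in passes w -> r.2 \in w.
  by move=> rw; rewrite -(unzip2_passes w); apply: map_f.
have neq2 : p.2 != q.2 by apply: contra neq_pq => /eqP/Up2-> //.
have := edge_side_chord u Ew (mem2 p pw) (mem2 q qw) neq2 atp2 atq2.
rewrite edge_side_passage // atp2 (negPf (indepX u v Xu Xv)) orbF.
by move: (edge_side w p.2.1 u) (edge_side w q.2.1 u) (v == u) => [] [] [].
Qed.

(** An induction principle for regions, transferring [same_side_related] from positions to edges. It
    is applied with connectedness inside a region, and with membership in the same cycle of a
    decomposition. *)
Lemma same_region_related w X (R : edge Gam -> edge Gam -> Prop) :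
    euler_tour w -> {in X &, forall u v, ~~ tour_adj w u v} ->
    (forall f, R f f) -> (forall f g, R f g -> R g f) ->
    (forall f g h, R f g -> R g h -> R f h) ->
    (forall p, p \in passes w -> att p.2 \notin X -> R p.1.1 p.2.1) ->
    (forall v p q, v \in X -> p \in pass_at w v -> q \in pass_at w v -> p != q ->
       R p.1.1 q.2.1) ->
  forall f g, region w X f = region w X g -> R f g.
Proof.
move=> Ew indepX Rxx Rsym Rtrans Rstep Rjump f g.
have [Uw allw _] := Ew.
have /mapP[b bw ->] := allw f; have /mapP[c cw ->] := allw g; move: b c bw cw.
have sz : size (tour_vertices w) = size w by rewrite size_map.
wlog suff le_case : / forall b c, b \in w -> c \in w -> index b w <= index c w ->
    region w X b.1 = region w X c.1 -> R b.1 c.1.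
  move=> b c bw cw; case/orP: (leq_total (index b w) (index c w)) => le_bc eq_r.
    exact: le_case.
  by apply: Rsym; apply: le_case.
move=> b c bw cw le_bc /eqP/eq_regionP eq_s.
have lt_c : index c w < size w by rewrite index_mem.
have lt_b : index b w < size w by rewrite index_mem.
have passP i : i.+1 < size w -> (opp (nth b w i), nth b w i.+1) \in passes w.
  move=> lt_i; apply/(nthP (b, b)); exists i.+1.
    by rewrite (passesE b) size_pairmap.
  by rewrite (passesE b) (nth_pairmap b).
have nth_att i : i < size w -> nth (att b) (tour_vertices w) i = att (nth b w i).
  by move=> lt_i; rewrite (nth_map b).
rewrite -(nth_index b bw) -(nth_index b cw).
apply: (@same_side_related _ (att b) (tour_vertices w) [in X]
  (fun i j => R (nth b w i).1 (nth b w j).1)) => //.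
- by move=> u _; apply: count_tour_vertices.
- move=> u v Xu Xv neq_uv; have := indepX v u Xv Xu.
  by rewrite (tour_adjE reg4) // eq_sym neq_uv.
- by move=> i j k; apply: Rtrans.
- move=> i; rewrite sz => lt_i; rewrite nth_att // => notX.
  exact: (Rstep _ (passP i lt_i) notX).
- move=> i j; rewrite sz => /andP[lt_ij lt_j]; rewrite !nth_att //;
  last exact: ltn_trans lt_j.
  case: j lt_ij lt_j => // j lt_ij lt_j eq_att Xj.
  have lt_i := ltn_trans lt_ij lt_j.
  apply: (Rjump (att (nth b w j.+1)) (opp (nth b w i), nth b w i.+1)
    (opp (nth b w j), nth b w j.+1)) => //.
  + rewrite mem_filter passP // andbT.
    by rewrite (eqP (allP (passes_att Ew) _ (passP i lt_i))) /= eq_att.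
  + rewrite mem_filter passP // andbT.
    by rewrite (eqP (allP (passes_att Ew) _ (passP j lt_j))) /=.
  by rewrite xpair_eqE nth_uniq ?(euler_tour_uniq Ew) // (ltn_eqF lt_ij) andbF.
- by rewrite le_bc sz.
by move=> u Xu; have := eq_s u Xu; rewrite -{1}(nth_index b bw) -{1}(nth_index b cw)
  !edge_side_nth.
Qed.

End Regions.

(** * Orthogonal cycle decompositions *)

Section Decompositions.
Variables (Gam : mgraph) (T : vert Gam -> {set {set edge_end Gam}}).
Hypotheses (reg4 : four_regular Gam) (trT : transition_system T).
Implicit Types (u v : vert Gam) (d e x y : edge_end Gam) (w s : seq (edge_end Gam)).
Implicit Types (X : {set vert Gam}).

(** Leaving open how the ends are paired lets this serve both for the passages of the tour and for
    the switched pairs. *)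
Lemma ends_in_class (A : eqType) (F : edge Gam -> A) u a b c d f :
    ends_at u = [set a; b; c; d] -> F a.1 = F b.1 -> F c.1 = F d.1 -> F a.1 != F c.1
      ->
    let C := [set g | F g == F f] in u \in verts_of C ->
  ends_in C u = [set a; b] \/ ends_in C u = [set c; d].
Proof.
move=> def_u Fab Fcd neqF C; rewrite inE => /set0Pn[h].
rewrite !inE => /andP[hu /eqP Fh].
have ends_inE : ends_in C u =
    [set k in [set a; b] | F a.1 == F f] :|: [set k in [set c; d] | F c.1 == F f].
  apply/setP=> k; rewrite [LHS]inE def_u !inE; case: (eqVneq k a) => [->|_] /=.
    case: (eqVneq a c) => [<- | _] /=; first by rewrite orbb.
    case: (eqVneq a d) => [eq_ad | _] /=; last by rewrite orbF.
    by rewrite Fcd -eq_ad orbb.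
  case: (eqVneq k b) => [->|_] /=.
    rewrite -Fab; case: (eqVneq b c) => [<- | _] /=; first by rewrite -Fab orbb.
    case: (eqVneq b d) => [eq_bd | _] /=; last by rewrite orbF.
    by rewrite Fcd -eq_bd -Fab orbb.
  case: (eqVneq k c) => [->|_] //=.
  by case: (eqVneq k d) => [->|_] //=; rewrite -Fcd.
have : h \in ends_in C u by rewrite !inE hu Fh eqxx.
rewrite ends_inE !inE => /orP[/andP[_ /eqP Fa] | /andP[_ /eqP Fc]].
  left; apply/setP=> k; rewrite !inE -Fa eqxx andbT.
  by rewrite [F c.1 == _]eq_sym (negPf neqF) andbF orbF.
by right; apply/setP=> k; rewrite !inE -Fc eqxx andbT (negPf neqF) andbF.
Qed.

Lemma joined_in_sym (C : {set edge Gam}) : symmetric (joined_in C).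
Proof.
suff imp u v : joined_in C u v -> joined_in C v u by move=> u v; apply/idP/idP;
  apply: imp.
case/existsP=> h /and3P[hC hu hv]; apply/existsP; exists (opp h).
by rewrite oppK hC hv.
Qed.

Lemma connect_ends (C : {set edge Gam}) h k :
  h.1 \in C -> h.1 = k.1 -> connect (joined_in C) (att h) (att k).
Proof.
case: h k => f b [g b'] /= fC <-; case: (eqVneq b b') => [-> | neq_b];
  first exact: connect0.
apply: connect1; apply/existsP; exists (f, b); rewrite /= fC eqxx /opp /=.
by case: b b' neq_b => -[].
Qed.

(** The cycles are the sets of edges lying in one region. Degree two is checked at each vertex, and
    connectedness comes from [same_region_related]. *)
Lemma black_anticlique_decomposition w X : orthogonal_tour T w ->
    {in X, forall u, tour_black T w u} ->
    {in X &, forall u v, ~~ tour_adj w u v} ->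
    (forall v, v \notin X -> exists2 u, u \in X & tour_adj w u v) ->
  exists D : {set {set edge Gam}},
    cycle_decomposition D /\ orthogonal T (decomposition_pairs D).
Proof.
move=> Ow blackX indepX maxX; have [Ew orth] := Ow.
pose F := region w X; pose cls f := [set g | F g == F f].
have mem2 p : p \in passes w -> p.2 \in w.
  by move=> pw; rewrite -(unzip2_passes w); apply: map_f.
have ends_cls f u : u \in verts_of (cls f) ->
    #|ends_in (cls f) u| = 2 /\ ends_in (cls f) u \notin T u.
  move=> uC; have [a [b [c [d [def_l U4 def_u]]]]] := pass_at_four u reg4 Ew.
  have abu : (a, b) \in pass_at w u by rewrite def_l mem_head.
  have cdu : (c, d) \in pass_at w u by rewrite def_l !inE eqxx orbT.
  have [abw cdw] : (a, b) \in passes w /\ (c, d) \in passes w.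
    by move: abu cdu; rewrite !mem_filter => /andP[_ ->] /andP[_ ->].
  have at4 h : h \in [set a; b; c; d] -> att h = u.
    by rewrite -def_u inE => /eqP.
  have [ata atb atc atd] : [/\ att a = u, att b = u, att c = u & att d = u].
    by split; apply: at4; rewrite !inE eqxx ?orbT.
  have := U4; rewrite /= !inE !negb_or andbT => /and3P[/and3P[ab ac ad] /andP[bc bd]
    cd].
  have chord v := edge_side_chord reg4 v Ew (mem2 _ abw) (mem2 _ cdw) bd atb atd.
  (* At [u] in [X] the regions pair the ends in the switched way, and the chord [u] separates the
     two pairs. Elsewhere they keep the passages of [w], separated by a chord of [X] that crosses
     [u], given by maximality. *)
  have [Xu | notXu] := boolP (u \in X).
    have Fad : F a.1 = F d.1.
      apply: (region_jump reg4 Ew indepX Xu abu cdu).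
      by rewrite xpair_eqE (negPf ac).
    have Fcb : F c.1 = F b.1.
      apply: (region_jump reg4 Ew indepX Xu cdu abu).
      by rewrite xpair_eqE eq_sym (negPf ac).
    have neqF : F a.1 != F c.1.
      apply/negP=> /eq_regionP/(_ u Xu).
      rewrite (edge_side_passage reg4 u Ew abw) (edge_side_passage reg4 u Ew cdw) /=.
      have := chord u; rewrite /= atb atd eqxx /=.
      by case: (edge_side w b.1 u); case: (edge_side w d.1 u).
    have [dis _] : [disjoint pairs_of [:: (a, d); (c, b)] & T u] /\
        pairs_of [:: (a, d); (c, b)] != pairs_of [:: (a, b); (c, d)].
      apply: crossing_black; first by rewrite -def_l; apply: pass_at_crossing.
      by rewrite -def_l -tour_blackE; apply: blackX.
    move: dis; rewrite pairs_of2 disjoint_set2 => /andP[adT cbT].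
    have def_u' : ends_at u = [set a; d; c; b].
      by rewrite def_u (setUAC [set a]) (setUAC (_ :|: _)) (setUAC [set a]) (setUAC
        (_ :|: _)).
    have [->|->] := ends_in_class def_u' Fad Fcb neqF uC; first by rewrite cards2 ad.
    by rewrite cards2 eq_sym bc.
  have Fab : F a.1 = F b.1 by apply: (region_passage reg4 Ew abw); rewrite /= atb.
  have Fcd : F c.1 = F d.1 by apply: (region_passage reg4 Ew cdw); rewrite /= atd.
  have neqF : F a.1 != F c.1.
    have [v Xv adj_vu] := maxX u notXu; rewrite Fab Fcd.
    apply/negP=> /eq_regionP/(_ v Xv) eq_s; have := chord v.
    by rewrite /= eq_s addbb adj_vu orbT.
  have := orth u; rewrite tour_pairsE ?euler_tour_uniq // def_l pairs_of2
    disjoint_set2.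
  case/andP=> abT cdT.
  by have [->|->] := ends_in_class def_u Fab Fcd neqF uC; rewrite cards2 ?ab ?cd.
exists [set cls f | f : edge Gam]; split; last first.
  move=> u; rewrite disjoints_subset; apply/subsetP=> P /imsetP[C].
  rewrite inE => /andP[/imsetP[f _ ->] uC] ->; rewrite inE.
  by have [] := ends_cls f u uC.
split.
  apply/and3P; split.
  - apply/eqP/setP=> f; rewrite inE; apply/bigcupP; exists (cls f);
    last by rewrite inE.
    exact: imset_f.
  - apply/trivIsetP=> _ _ /imsetP[f _ ->] /imsetP[g _ ->] neq_C.
    rewrite -setI_eq0; apply: contraNT neq_C => /set0Pn[h].
    by rewrite !inE => /andP[/eqP eq_f /eqP eq_g]; rewrite /cls -eq_f -eq_g.
  apply/imsetP=> -[f _ /setP/(_ f)]; by rewrite !inE eqxx.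
move=> _ /imsetP[f _ ->]; split; last by move=> u /ends_cls[].
split.
  apply/set0Pn; exists (att (f, true)); rewrite inE; apply/set0Pn; exists (f, true).
  by rewrite !inE !eqxx.
(* Membership in the class is carried along with connectedness, so that this conditional relation is
   symmetric and transitive. *)
pose R g g' := (g \in cls f) = (g' \in cls f) /\
  (g \in cls f -> forall h h' : edge_end Gam, h.1 = g -> h'.1 = g' ->
     connect (joined_in (cls f)) (att h) (att h')).
have R_ends h k : F h.1 = F k.1 -> att h = att k -> R h.1 k.1.
  move=> eqF eq_att; split; first by rewrite !inE eqF.
  move=> hC h' k' eq_h eq_k; apply: (@connect_trans _ _ (att h)).
    by apply: connect_ends; rewrite ?eq_h.
  rewrite eq_att; apply: connect_ends; rewrite ?eq_k //.
  by move: hC; rewrite !inE eqF.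
have R_same g g' : F g = F g' -> R g g'.
  apply: (same_region_related reg4 (R := R) Ew indepX).
  - by move=> g1; split=> // g1C h h' eq_h eq_h'; apply: connect_ends; rewrite eq_h.
  - move=> g1 g2 [eqC con]; split=> // g2C h h' eq_h eq_h'.
    by rewrite (sym_connect_sym (joined_in_sym (cls f))); apply: con => //;
      rewrite eqC.
  - move=> g1 g2 g3 [eq12 con12] [eq23 con23]; split; first by rewrite eq12.
    move=> g1C h h' eq_h eq_h'; apply: (connect_trans (con12 g1C h (g2, true) eq_h
      _)) => //.
    by apply: con23; rewrite -?eq12.
  - move=> p pw notX; apply: R_ends; last by apply/eqP; apply: (allP (passes_att Ew)).
    exact: region_passage.
  move=> v p q Xv pv qv neq_pq; apply: R_ends; first exact: (region_jump reg4 Ew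
    indepX Xv).
  move: pv qv; rewrite !mem_filter => /andP[/eqP-> _] /andP[/eqP <- qw].
  by apply/eqP; apply: (allP (passes_att Ew)).
move=> u v; rewrite !inE => /set0Pn[h] + /set0Pn[k].
rewrite !inE => /andP[/eqP <- /eqP hC] /andP[/eqP <- /eqP kC].
have [_] := R_same h.1 k.1 (etrans hC (esym kC)).
by apply; rewrite // inE hC.
Qed.

(** Each end at [u] belongs to the cycle of its edge, so the partition of the edges restricts to the
    ends at [u]; each cycle met there has two of them. *)
Lemma decomposition_pairing (D : {set {set edge Gam}}) u :
  cycle_decomposition D -> pairing (decomposition_pairs D u) (ends_at u).
Proof.
case=> /and3P[/eqP covD trivD D0] cycD; split; last first.
  move=> P /imsetP[C]; rewrite inE => /andP[CD uC] ->.
  by have [_] := cycD C CD; apply.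
apply/and3P; split.
- apply/eqP/setP=> h; apply/bigcupP/idP=> [[P /imsetP[C _ ->]] | hu].
    by rewrite inE => /andP[].
  have /bigcupP[C CD hC] : h.1 \in cover D by rewrite covD inE.
  exists (ends_in C u); last by rewrite inE hu.
  apply: imset_f; rewrite !inE CD /=; apply/set0Pn; exists h.
  by rewrite inE hu.
- apply/trivIsetP=> _ _ /imsetP[C + ->] /imsetP[C' + ->] neq_ends.
  rewrite !inE => /andP[CD _] /andP[CD' _].
  have neq_C : C != C' by apply: contra neq_ends => /eqP->.
  have /pred0P dis := trivIsetP trivD _ _ CD CD' neq_C.
  rewrite -setI_eq0; apply/eqP/setP=> h; rewrite !inE.
  have := dis h.1; rewrite /=; case: (h.1 \in C) => /= [->|_]; rewrite ?andbF //.
apply/imsetP=> -[C]; rewrite !inE => /andP[_ /set0Pn[h hC]] eq0.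
by rewrite -eq0 inE in hC.
Qed.

(* The edges with ends a, b paired by D lie in one cycle, whence so do the edges
   of each region of the tour; at a vertex outside X crossing no chord of X, all
   four ends would then belong to one cycle. *)
Lemma decomposition_differences_maximal D w : cycle_decomposition D ->
    orthogonal T (decomposition_pairs D) -> orthogonal_tour T w ->
    {in differences (decomposition_pairs D) w, forall u, tour_black T w u} ->
    {in differences (decomposition_pairs D) w &, forall u v, ~~ tour_adj w u v} ->
  forall v, v \notin differences (decomposition_pairs D) w ->
    exists2 u, u \in differences (decomposition_pairs D) w & tour_adj w u v.
Proof.
set X := differences _ w => cycD orthD Ow blackX indepX v notXv; have [Ew orth] := Ow.
have [/and3P[/eqP covD trivD D0] _] := cycD.
have prD u := decomposition_pairing u cycD.
suff /existsP[u /andP[]] : [exists u, (u \in X) && tour_adj w u v] by exists u.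
apply: contraT; rewrite negb_exists => /forallP no_adj.
pose R f g := forall C, C \in D -> (f \in C) = (g \in C).
have R_pair h k u : [set h; k] \in decomposition_pairs D u -> R h.1 k.1.
  case/imsetP=> C; rewrite inE => /andP[CD _] /setP eq_ends C' C'D.
  have hC : h.1 \in C by have := eq_ends h; rewrite !inE eqxx => /esym/andP[].
  have kC : k.1 \in C by have := eq_ends k; rewrite !inE eqxx orbT => /esym/andP[].
  have [-> | neq_C] := eqVneq C' C; first by rewrite hC kC.
  have /pred0P dis := trivIsetP trivD _ _ C'D CD neq_C.
  have := dis h.1; have := dis k.1.
  by rewrite /= hC kC !andbT => -> ->.
have R_region f g : region w X f = region w X g -> R f g.
  apply: (same_region_related reg4 (R := R) Ew indepX) => //.
  - by move=> f1 g1 fg C CD; rewrite fg.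
  - by move=> f1 g1 h1 fg gh C CD; rewrite fg ?gh.
  - move=> [h k] pw; rewrite inE negbK /= => /eqP eq_pairs.
    apply: (R_pair h k (att k)); rewrite -eq_pairs tour_pairsE ?euler_tour_uniq //.
    apply/imsetP; exists (h, k); rewrite // mem_filter pw andbT.
    exact: (allP (passes_att Ew) _ pw).
  move=> u p q Xu; have [a [b [c [d [def_l U4 def_u]]]]] := pass_at_four u reg4 Ew.
  have prDu := prD u; have prTu : pairing (T u) (ends_at u) := trT u.
  rewrite def_u in prDu prTu.
  have [_ _ bcD memD] := pairing_mem U4 prDu.
  (* Blackness puts [{a, c}] into [T], which excludes it from [D]; [{a, b}] would make [D] agree
     with the tour at [u]. So [D] pairs [a] with [d] and [b] with [c], as a jump requires. *)
  have acT : [set a; c] \in T u.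
    have := blackX u Xu; rewrite tour_blackE def_l aligned2 //; first by case: prTu.
    by move: U4; rewrite /= !inE !negb_or; case: (a != c); rewrite ?andbF.
  have acD : [set a; c] \in decomposition_pairs D u = false.
    exact: (disjointFl (orthD u) acT).
  have abD : [set a; b] \in decomposition_pairs D u = false.
    apply/negP=> abD; move: Xu; rewrite inE tour_pairsE ?euler_tour_uniq // def_l.
    by rewrite pairs_of2 (pairing_eq_cons U4 prDu abD) eqxx.
  have adD : [set a; d] \in decomposition_pairs D u.
    by move: memD; rewrite acD abD !inE; case: (_ \in _).
  rewrite adD in bcD.
  rewrite def_l !inE => /orP[] /eqP-> /orP[] /eqP->; rewrite ?eqxx // => _.
    exact: R_pair adD.
  by apply: (R_pair c b u); rewrite setUC.
have [a [b [c [d [def_l U4 def_v]]]]] := pass_at_four v reg4 Ew.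
have abv : (a, b) \in pass_at w v by rewrite def_l mem_head.
have cdv : (c, d) \in pass_at w v by rewrite def_l !inE eqxx orbT.
have [abw cdw] : (a, b) \in passes w /\ (c, d) \in passes w.
  by move: abv cdv; rewrite !mem_filter => /andP[_ ->] /andP[_ ->].
have at4 h : h \in [set a; b; c; d] -> att h = v.
  by rewrite -def_v inE => /eqP.
have [atb atd] : att b = v /\ att d = v.
  by split; apply: at4; rewrite !inE eqxx ?orbT.
have mem2 p : p \in passes w -> p.2 \in w.
  by move=> pw; rewrite -(unzip2_passes w); apply: map_f.
have := U4; rewrite /= !inE !negb_or andbT => /and3P[/and3P[ab ac ad] /andP[bc bd]
  cd].
(* No chord of [X] crosses [v] or equals it, so none separates the two passages at [v]. *)
have R_bd : R b.1 d.1.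
  apply: R_region; apply/eqP/eq_regionP=> u Xu; apply/eqP.
  have := edge_side_chord reg4 u Ew (mem2 _ abw) (mem2 _ cdw) bd atb atd.
  have := no_adj u; rewrite Xu /= => /negPf->; rewrite orbF.
  case: eqP => [eq_vu | _]; first by rewrite eq_vu Xu in notXv.
  by case: (edge_side w b.1 u); case: (edge_side w d.1 u).
have : [set a; b] \in decomposition_pairs D v.
  move: notXv; rewrite inE negbK => /eqP <-.
  by rewrite tour_pairsE ?euler_tour_uniq // def_l pairs_of2 !inE eqxx.
case/imsetP=> C; rewrite inE => /andP[CD _] /setP eq_ends.
have bC : b.1 \in C by have := eq_ends b; rewrite !inE eqxx orbT => /esym/andP[].
(* The cycle with end pair [{a, b}] at [v] would also contain the edge of [d], a third end. *)
have := eq_ends d; rewrite !inE -(R_bd C CD) bC atd eqxx.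
by rewrite ![d == _]eq_sym (negPf ad) (negPf bd).
Qed.

End Decompositions.

Theorem theorem2p5p18 (Gam : mgraph)
    (T : vert Gam -> {set {set edge_end Gam}}) (w : seq (edge_end Gam)) :
  connected Gam -> four_regular Gam -> transition_system T ->
  euler_tour w -> orthogonal T (tour_pairs w) ->
  (~ (exists D : {set {set edge Gam}},
        cycle_decomposition D /\ orthogonal T (decomposition_pairs D)))
  <-> pure (parity_class (tour_graph T w)).
Proof.
move=> _ reg4 trT Ew orth; have Ow : orthogonal_tour T w by [].
split=> [noD H [s adm ->] [X] | pureG [D [cycD orthD]]].
  case/andP=> /maxsetP[/forall_inP indepX maxX] /forall_inP blackX; apply: noD.
  have [w' Ow' [eq_adj eq_black]] := admissible_tour reg4 trT Ow adm.
  apply: (black_anticlique_decomposition reg4 trT Ow' (X := X)).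
  - by move=> u Xu; rewrite [tour_black _ _ _]eq_black blackX.
  - move=> u v Xu Xv; rewrite [tour_adj _ _ _]eq_adj.
    by have /forall_inP := indepX u Xu; apply.
  move=> v notXv.
  suff /existsP[u /andP[]] : [exists u, (u \in X) && tour_adj w' u v] by exists u.
  apply: contraR notXv; rewrite negb_exists => /forallP no_adj.
  have no_adj_v u : u \in X -> ~~ adj (lcs (tour_graph T w) s) u v.
    by move=> Xu; have := no_adj u; rewrite Xu -eq_adj.
  (* A vertex without neighbour in [X] could be added to [X], whatever its colour; maximality among
     all independent sets puts it in [X]. *)
  rewrite -(maxX (v |: X)) ?setU11 ?subsetUr //.
  apply/forall_inP=> u; rewrite in_setU1 => u_vX.
  apply/forall_inP=> u'; rewrite in_setU1 => u'_vX.
  case/predU1P: u_vX => [-> | Xu]; case/predU1P: u'_vX => [-> | Xu'].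
  - by rewrite adj_irr.
  - by rewrite adj_sym no_adj_v.
  - exact: no_adj_v.
  by have /forall_inP := indepX u Xu; apply.
have prD u := decomposition_pairing u cycD.
have [s [w' [adm Ow' [eq_adj eq_black] blackX indepX]]] :=
  closest_tour reg4 trT prD orthD Ow.
have maxX := decomposition_differences_maximal reg4 trT cycD orthD Ow' blackX indepX.
set X := differences _ _ in blackX indepX maxX.
apply: (pureG (lcs (tour_graph T w) s)); first by exists s.
exists X; apply/andP; split; last first.
  by apply/forall_inP=> u Xu; rewrite -eq_black; apply: blackX.
apply/maxsetP; split.
  apply/forall_inP=> u Xu; apply/forall_inP=> v Xv.
  by rewrite -eq_adj; apply: indepX.
move=> B /forall_inP indepB subXB; apply/eqP; rewrite eqEsubset subXB andbT.
(* A vertex of [B] outside [X] would have a neighbour in [X], contradicting the independence of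
   [B]. *)
apply/subsetP=> v Bv; apply: contraT => /maxX[u Xu adj_uv].
have /forall_inP/(_ v Bv) := indepB u (subsetP subXB u Xu).
by rewrite -eq_adj /= adj_uv.
Qed.
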